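(* Let $d\ge2$, let $\mathbf{t}=(t_1,\dots,t_{d-1})\in\mathbb{N}^{d-1}$, where $\mathbb{N}$ is the set of all non-negative integers, and let $I$ be a $\mathbf{t}$-spread strongly stable ideal of $E=K\langle e_1,\dots,e_n\rangle$. Then, for all $i\ge0$ and all $j\ge1$, $$\beta_{i,i+j}(I)=\sum_{u\in G(I)_j}\binom{\mathrm{m}(u)-\sum_{h=1}^{j-1}(t_h-1)+i-1}{i}.$$
   Context: $K$ is a field, $n\ge1$, and $E=K\langle e_1,\dots,e_n\rangle$ is the exterior algebra of a $K$-vector space with basis $e_1,\dots,e_n$, standard graded. For $\mu=\{i_1<\dots<i_\ell\}\subseteq\{1,\dots,n\}$, $e_\mu=e_{i_1}\cdots e_{i_\ell}$ is called a monomial (monomials are considered up to sign), with $\mathrm{supp}(e_\mu)=\mu$ and, for $e_\mu\ne1$, $\mathrm{m}(e_\mu)=\max\mu$. A monomial ideal is an ideal generated by monomials; $G(I)$ is its unique minimal set of monomial generators, and $G(I)_j$ is the set of elements of $G(I)$ of degree $j$. For a graded $E$-module $M$, $\beta_{i,j}(M)=\dim_K\mathrm{Tor}_i^E(M,K)_j$ are the graded Betti numbers of $M$. A monomial $e_\mu=e_{i_1}\cdots e_{i_\ell}\ne1$, with $1\le i_1<\dots<i_\ell\le n$ and $\ell\le d$, is $\mathbf{t}$-spread if $i_{j+1}-i_j\ge t_j$ for all $j=1,\dots,\ell-1$. A monomial ideal is $\mathbf{t}$-spread if it is generated by $\mathbf{t}$-spread monomials. A $\mathbf{t}$-spread monomial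 ideal $I$ is $\mathbf{t}$-spread strongly stable if for all $\mathbf{t}$-spread monomials $e_\mu\in I$, all $j\in\mathrm{supp}(e_\mu)$ and all $i<j$ such that $e_ie_{\mu\setminus\{j\}}$ is $\mathbf{t}$-spread, it follows that $e_ie_{\mu\setminus\{j\}}\in I$.
   Formalization: The formula is false when some t_h = 0 (n = d = 2, t = (0), I = (e_1e_2): β_{1,3}(I) = 2, formula gives 3), so t_h − 1 is read as max(t_h,1) − 1; for all t_h ≥ 1 the formula is unchanged. *)

(* Defs.v *)
From HB Require Import structures.
From mathcomp Require Import all_boot all_order all_algebra all_field.

Set Implicit Arguments.
Unset Strict Implicit.
Unset Printing Implicit Defensive.

Import GRing.Theory.
Local Open Scope ring_scope.

(* The exterior algebra K<e_1, ..., e_n>, in coordinates on the monomial      *)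
(* basis (e_S), S a subset of 'I_n = {0, ..., n-1}: the variable written e_i  *)
(* on paper is attached to the ordinal i - 1.                                 *)
Definition ext (K : fieldType) (n : nat) := {ffun {set 'I_n} -> K^o}.

Section ExteriorAlgebra.
Variables (K : fieldType) (n : nat).
Local Notation E := (ext K n).
Implicit Types (S T U : {set 'I_n}) (x y z : E).

HB.instance Definition _ := Vector.copy E {ffun {set 'I_n} -> K^o}.

Definition ext_inv S T : nat := (\sum_(i in S) \sum_(j in T) (j < i))%N.

(* e_S e_T = (-1)^(number of pairs (i,j) in S x T with j < i) e_(S u T) if S  *)
(* and T are disjoint, and e_S e_T = 0 otherwise.                             *)
Definition ext_mul x y : E :=
  [ffun U : {set 'I_n} => \sum_(S : {set 'I_n} | S \subset U)
     (-1) ^+ ext_inv S (U :\: S) * (x S * y (U :\: S))].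

Definition emon S : E := [ffun T => (T == S)%:R].

Lemma ext_inv0l T : ext_inv set0 T = 0%N.
Proof. by rewrite /ext_inv big_set0. Qed.

Lemma ext_inv0r S : ext_inv S set0 = 0%N.
Proof. by rewrite /ext_inv big1 // => i _; rewrite big_set0. Qed.

Lemma ext_invUl S T U : [disjoint S & T] ->
  ext_inv (S :|: T) U = (ext_inv S U + ext_inv T U)%N.
Proof.
move=> dST; rewrite /ext_inv -bigU //=.
by apply: eq_bigl => i; rewrite !inE.
Qed.

Lemma ext_invUr S T U : [disjoint T & U] ->
  ext_inv S (T :|: U) = (ext_inv S T + ext_inv S U)%N.
Proof.
move=> dTU; rewrite /ext_inv -big_split; apply: eq_bigr => i _.
by rewrite -bigU //=; apply: eq_bigl => j; rewrite !inE.
Qed.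

Fact setUDsub S T : S \subset T -> S :|: (T :\: S) = T.
Proof.
move=> sST; apply/setP => i; rewrite !inE.
by have /implyP := subsetP sST i; do 2!case: (i \in _).
Qed.

Lemma ext_mulA : associative ext_mul.
Proof.
move=> x y z; apply/ffunP => U; rewrite !ffunE.
transitivity (\sum_(S : {set 'I_n} | S \subset U)
   \sum_(V : {set 'I_n} | (S \subset V) && (V \subset U))
     (-1) ^+ (ext_inv S (U :\: S) + ext_inv (V :\: S) (U :\: V))
       * (x S * y (V :\: S) * z (U :\: V)) : K).
  apply: eq_bigr => S sSU; rewrite ffunE !mulr_sumr.
  rewrite (reindex_onto (fun V => V :\: S) (fun T => S :|: T)); last first.
    move=> T; rewrite subsetD => /andP[_ dTS].
    by rewrite setDUl setDv set0U; apply/setDidPl.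
  apply: eq_big => [V|V].
    apply/andP/andP => [[sV /eqP <-]|[sSV sVU]].
      rewrite subsetUl subUset sSU; split=> //.
      by apply: subset_trans sV _; apply: subsetDl.
    by split; [apply: setSD | rewrite setUDsub].
  move=> /andP[sVSU /eqP defV].
  have -> : U :\: S :\: (V :\: S) = U :\: V.
    by rewrite setDDl defV.
  by rewrite exprD -!mulrA; congr (_ * _); rewrite mulrCA.
rewrite (exchange_big_dep (fun V : {set 'I_n} => V \subset U)) /=; last by move=> S V _ /andP[].
apply: eq_bigr => V sVU; rewrite ffunE mulr_suml mulr_sumr.
apply: eq_big => [S|S /and3P[sSU sSV _]].
  by case sSV: (S \subset V); rewrite ?andbF ?sVU ?andbT //= (subset_trans sSV).
have defUS : U :\: S = (V :\: S) :|: (U :\: V).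
  apply/setP => i; rewrite !inE.
  by have /implyP := subsetP sSV i; have /implyP := subsetP sVU i;
     do 3!case: (i \in _).
have dis (A B C : {set 'I_n}) : [disjoint A :\: B & C :\: A].
  by rewrite -setI_eq0; apply/eqP/setP => i; rewrite !inE;
     case: (i \in A); rewrite ?andbF.
have defV : V = S :|: (V :\: S) by rewrite setUDsub.
rewrite defUS ext_invUr ?dis //.
have -> : ext_inv V (U :\: V) =
    (ext_inv S (U :\: V) + ext_inv (V :\: S) (U :\: V))%N.
  rewrite {1}defV ext_invUl // -setI_eq0; apply/eqP/setP => i; rewrite !inE.
  by case: (i \in S); rewrite ?andbF.
by rewrite -addnA exprD -!mulrA mulrCA.
Qed.

Lemma ext_mul1x : left_id (emon set0) ext_mul.
Proof.
move=> x; apply/ffunP => U; rewrite ffunE (bigD1 set0) ?sub0set //= big1.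
  by rewrite !ffunE eqxx ext_inv0l expr0 !mul1r setD0 addr0.
by move=> S /andP[_ /negPf nS0]; rewrite ffunE nS0 mul0r mulr0.
Qed.

Lemma ext_mulx1 : right_id (emon set0) ext_mul.
Proof.
move=> x; apply/ffunP => U; rewrite ffunE (bigD1 U) //= big1.
  by rewrite !ffunE setDv eqxx ext_inv0r expr0 mul1r mulr1 addr0.
move=> S /andP[sSU nSU]; rewrite ffunE.
case: eqP => [|_]; last by rewrite !mulr0.
by move=> /eqP; rewrite setD_eq0 => sUS; case/negP: nSU; rewrite eqEsubset sSU.
Qed.

Lemma ext_mulDl : left_distributive ext_mul +%R.
Proof.
move=> x y z; apply/ffunP => U; rewrite !ffunE -big_split.
by apply: eq_bigr => S _; rewrite ffunE mulrDl mulrDr.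
Qed.

Lemma ext_mulDr : right_distributive ext_mul +%R.
Proof.
move=> x y z; apply/ffunP => U; rewrite !ffunE -big_split.
by apply: eq_bigr => S _; rewrite ffunE !mulrDr.
Qed.

Lemma emon_neq0 S : emon S != 0.
Proof. by apply/eqP => /ffunP/(_ S)/eqP; rewrite !ffunE eqxx oner_eq0. Qed.

HB.instance Definition _ := GRing.Zmodule_isNzRing.Build E
  ext_mulA ext_mul1x ext_mulx1 ext_mulDl ext_mulDr (emon_neq0 set0).

Lemma ext_scaleAl (c : K) x y : c *: (x * y) = (c *: x) * y.
Proof.
apply/ffunP => U; rewrite !ffunE scaler_sumr; apply: eq_bigr => S _.
by rewrite ffunE /GRing.scale /= mulrCA !mulrA.
Qed.

HB.instance Definition _ := GRing.Lmodule_isLalgebra.Build K E ext_scaleAl.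

Lemma ext_scaleAr (c : K) x y : c *: (x * y) = x * (c *: y).
Proof.
apply/ffunP => U; rewrite !ffunE scaler_sumr; apply: eq_bigr => S _.
by rewrite ffunE /GRing.scale /= mulrCA; congr (_ * _); rewrite mulrCA.
Qed.

HB.instance Definition _ := GRing.Lalgebra_isAlgebra.Build K E ext_scaleAr.
HB.instance Definition _ := Algebra_isFalgebra.Build K E.

Lemma ext_mulE x y U : (x * y) U = \sum_(S : {set 'I_n} | S \subset U)
   (-1) ^+ ext_inv S (U :\: S) * (x S * y (U :\: S)).
Proof. by rewrite ffunE. Qed.

Lemma emon_mul S T : emon S * emon T =
  if [disjoint S & T] then (-1) ^+ ext_inv S T *: emon (S :|: T) else 0.
Proof.
apply/ffunP => U; rewrite ext_mulE.
have [/andP[sSU /eqP defT] | nU] := boolP ((S \subset U) && (U :\: S == T)).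
  rewrite (bigD1 S) //= big1 => [|S' /andP[_ /negPf nS']]; last first.
    by rewrite ffunE nS' mul0r mulr0.
  rewrite !ffunE eqxx defT eqxx -{}defT setUDsub // mulr1 addr0.
  rewrite ifT ?ffunE ?eqxx //.
  by rewrite -setI_eq0; apply/eqP/setP => i; rewrite !inE; case: (i \in S).
rewrite big1 => [|S' sS'U]; last first.
  rewrite !ffunE; case: eqP => [eS|]; last by rewrite mul0r mulr0.
  case: eqP => [eT|]; last by rewrite !mulr0.
  by rewrite -eS -eT sS'U eqxx in nU.
case: ifP => [dST|]; rewrite ?ffunE //; case: eqP => [eU|]; last by rewrite scaler0.
case/negP: nU; rewrite eU subsetUl setDUl setDv set0U; apply/eqP.
by apply/setDidPl; rewrite disjoint_sym.
Qed.

Lemma ext_sumE x : x = \sum_(S : {set 'I_n}) x S *: emon S.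
Proof.
apply/ffunP => U; rewrite sum_ffunE (bigD1 U) //= big1 => [|S nS].
  by rewrite !ffunE eqxx addr0 [RHS]mulr1.
by rewrite !ffunE eq_sym (negPf nS) scaler0.
Qed.

End ExteriorAlgebra.

Section MonomialIdeals.
Variables (K : fieldType) (n : nat).
Local Notation E := (ext K n).
Implicit Types (S T : {set 'I_n}) (A : {set {set 'I_n}}) (I : {vspace E}).

Definition ideal_gen A : {vspace E} :=
  (\sum_(S in A) {:E} * <[emon K S]> * {:E})%VS.

(* For a monomial ideal I, there is exactly one minimal set of monomial       *)
(* generators; see mingensP below.                                            *)
Definition mingens I : {set {set 'I_n}} :=
  odflt set0 [pick A | minset (fun B => ideal_gen B == I) A].

Definition maxsupp S : nat := (\max_(i in S) i.+1)%N.

Section Spread.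
Variables (d : nat) (t : d.-1.-tuple nat).

(* The k-th entry of t is t_(k+1), and enum S lists S in increasing order.    *)
(* Since e_i^2 = 0, t_h = 0 and t_h = 1 impose the same condition; this is    *)
(* why t_h - 1 has to be the truncated difference in formulas for Betti       *)
(* numbers, such as C(m(u) - sum_h (t_h - 1) + i - 1, i). With t_h - 1 = -1   *)
(* when t_h = 0, that one fails already for I = (e_1 e_2), n = d = 2 and      *)
(* t = (0), where beta_(1,3)(I) = 2 rather than 3.                            *)
Definition spread S : bool :=
  let s := [seq val i | i <- enum S] in
  [&& S != set0, (#|S| <= d)%N &
      [forall k : 'I_(#|S|.-1),
         (nth 0 t k <= nth 0 s k.+1 - nth 0 s k)%N]].

Definition spread_ideal I : Prop :=
  exists2 A : {set {set 'I_n}}, {in A, forall S, spread S} & I = ideal_gen A.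

Definition strongly_stable I : Prop :=
  spread_ideal I /\
  forall S, spread S -> emon K S \in I ->
  forall i j : 'I_n, j \in S -> (i < j)%N ->
    i \notin S -> spread (i |: (S :\ j)) ->
    emon K [set i] * emon K (S :\ j) \in I.

End Spread.

Definition ext_coord S (x : E) : K^o := x S.

Fact ext_coord_is_linear S : linear (ext_coord S).
Proof. by move=> c x y; rewrite /ext_coord !ffunE. Qed.

HB.instance Definition _ S := GRing.isSemilinear.Build K E K^o _ (ext_coord S)
  (GRing.semilinear_linear (ext_coord_is_linear S)).

Lemma memv_lker_coord S (x : E) :
  (x \in lker (linfun (ext_coord S))) = (x S == 0).
Proof. by rewrite memv_ker lfunE. Qed.

Fact disjoint_setD S T : [disjoint S & T :\: S].
Proof.
rewrite -setI_eq0; apply/eqP/setP => i; rewrite !inE.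
by case: (i \in S).
Qed.

Lemma sign_scaleK (m : nat) (x : E) : (-1 : K) ^+ m *: ((-1 : K) ^+ m *: x) = x.
Proof. by rewrite scalerA -exprD addnn -mul2n exprM sqrrN !expr1n scale1r. Qed.

Lemma mem_ideal_gen A (x : E) :
  (x \in ideal_gen A) =
  [forall S, (x S != 0) ==> [exists T, (T \in A) && (T \subset S)]].
Proof.
apply/idP/forallP => [/memv_sumP[v vP ->] S|xA]; last first.
  rewrite [x]ext_sumE; apply: memv_suml => S _.
  have [->|nz] := eqVneq (x S) 0; first by rewrite scale0r mem0v.
  have /existsP[T /andP[AT sTS]] := implyP (xA S) nz.
  apply/memvZ/(subvP (sumv_sup T AT (subvv _))).
  have := memv_mul (memv_mul (memvf (1 : E)) (memv_line (emon K T)))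
              (memvf (emon K (S :\: T))).
  rewrite mul1r emon_mul disjoint_setD setUDsub //.
  by move=> /(memvZ ((-1) ^+ ext_inv T (S :\: T))); rewrite sign_scaleK.
apply/implyP; apply: contraR; rewrite negb_exists => /forallP nA.
rewrite sum_ffunE big1 // => T AT; apply/eqP.
have nTS: ~~ (T \subset S) by move: (nA T); rewrite AT.
rewrite -memv_lker_coord; move: (v T) (vP T AT); apply/subvP/prodvP => w b wT _.
rewrite memv_lker_coord ext_mulE big1 // => V sVS.
suff -> : w V = 0 by rewrite mul0r mulr0.
have nTV : ~~ (T \subset V) by apply: contra nTS => /subset_trans; apply.
apply/eqP; rewrite -memv_lker_coord; move: w wT; apply/subvP/prodvP => a y _ /vlineP[c ->].
rewrite memv_lker_coord ext_mulE big1 // => W _.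
rewrite !ffunE; case: eqP => [eT|_]; last by rewrite scaler0 !mulr0.
by case/negP: nTV; rewrite -eT subsetDl.
Qed.

Lemma mem_emon_ideal_gen A S :
  (emon K S \in ideal_gen A) = [exists T, (T \in A) && (T \subset S)].
Proof.
rewrite mem_ideal_gen; apply/forallP/idP => [/(_ S)|SA S'].
  by rewrite ffunE eqxx oner_eq0.
by rewrite ffunE; have [->|_] := eqVneq S' S; rewrite ?SA ?implybT ?eqxx.
Qed.

Lemma mingensP A0 A : minset (fun B => ideal_gen B == ideal_gen A0) A =
  (A == mingens (ideal_gen A0)).
Proof.
pose P B := ideal_gen B == ideal_gen A0.
have unique B : minset P B ->
    B = [set S | minset (fun T => emon K T \in ideal_gen A0) S].
  move=> /minsetP[/eqP genB minB].
  have memB T : (emon K T \in ideal_gen A0) = [exists V, (V \in B) && (V \subset T)].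
    by rewrite -genB mem_emon_ideal_gen.
  have anti S T : S \in B -> T \in B -> T \subset S -> T = S.
    move=> BS BT sTS; apply/eqP; apply: contraT => nTS.
    suff /minB eB : P (B :\ S).
      by have := setD11 S B; rewrite eB ?subD1set ?BS.
    apply/eqP; rewrite -genB; apply/vspaceP => x; rewrite !mem_ideal_gen.
    apply: eq_forallb => U; congr (_ ==> _).
    apply/existsP/existsP => -[V].
      by rewrite !inE => /andP[/andP[_ BV] sVU]; exists V; rewrite BV.
    move=> /andP[BV sVU]; have [eVS|nVS] := eqVneq V S.
      by exists T; rewrite !inE nTS BT (subset_trans sTS) -?eVS.
    by exists V; rewrite !inE nVS BV.
  apply/setP => S; rewrite inE; apply/idP/minsetP => [BS|[]].
    split=> [|T]; rewrite memB; first by apply/existsP; exists S; rewrite BS /=.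
    move=> /existsP[V /andP[BV sVT]] sTS; apply/eqP.
    by rewrite eqEsubset sTS -(anti S V) // (subset_trans sVT).
  rewrite memB => /existsP[V /andP[BV sVS]] minS.
  by rewrite -(minS V) // memB; apply/existsP; exists V; rewrite BV /=.
rewrite /mingens; case: pickP => [B minB|no] /=.
  by apply/idP/eqP => [/unique->|->] //; rewrite -(unique B).
have [B minB _] := minset_exists (eqxx (ideal_gen A0) : P A0).
by have := no B; rewrite minB.
Qed.

End MonomialIdeals.

Section FreeModules.
Variables (K : fieldType) (n : nat).
Local Notation E := (ext K n).
Implicit Types (a b : seq nat).

(* The graded free left E-module E(-a_0) + ... + E(-a_(r-1)), where r is the  *)
(* length of a: its k-th basis element has degree a_k.                        *)
Definition fmod a := {ffun 'I_(size a) -> E}.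

HB.instance Definition _ a := Vector.copy (fmod a) {ffun 'I_(size a) -> E}.

Definition fscale a (x : E) (f : fmod a) : fmod a := [ffun k => x * f k].

Definition fproj a (j : nat) (f : fmod a) : fmod a :=
  [ffun k : 'I_(size a) => [ffun S : {set 'I_n} =>
     if (#|S| + nth 0 a k == j)%N then f k S else 0] : E].

Fact fproj_is_linear a j : linear (@fproj a j).
Proof.
move=> c f g; apply/ffunP => k; apply/ffunP => S; rewrite !ffunE.
by case: ifP; rewrite // scaler0 addr0.
Qed.

HB.instance Definition _ a j :=
  GRing.isSemilinear.Build K (fmod a) (fmod a) _ (@fproj a j)
  (GRing.semilinear_linear (@fproj_is_linear a j)).

Definition fdeg a j : {vspace fmod a} := limg (linfun (@fproj a j)).

Definition graded_submod a (N : {vspace fmod a}) : Prop :=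
  (forall x f, f \in N -> fscale x f \in N) /\
  (forall j f, f \in N -> fproj j f \in N).

(* The E-linear map sending the k-th basis element of fmod b to D k.          *)
Definition fhom b a (D : 'I_(size b) -> fmod a) (f : fmod b) : fmod a :=
  [ffun l : 'I_(size a) => \sum_k f k * D k l].

Fact fhom_is_linear b a (D : 'I_(size b) -> fmod a) : linear (fhom D).
Proof.
move=> c f g; apply/ffunP => l; rewrite !ffunE scaler_sumr -big_split.
by apply: eq_bigr => k _; rewrite !ffunE mulrDl scalerAl.
Qed.

HB.instance Definition _ b a (D : 'I_(size b) -> fmod a) :=
  GRing.isSemilinear.Build K (fmod b) (fmod a) _ (fhom D)
  (GRing.semilinear_linear (fhom_is_linear D)).

(* A sequence ... -> F_1 -> F_0 -> fmod a of graded free modules, where       *)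
(* F_i = fmod (shifts i) and the maps are given on the bases.                 *)
Record free_seq a := FreeSeq {
  shifts : nat -> seq nat;
  aug : 'I_(size (shifts 0%N)) -> fmod a;
  dif : forall i, 'I_(size (shifts i.+1)) -> fmod (shifts i) }.

Arguments aug {a} f k : rename.
Arguments dif {a} f i k : rename.

Definition free_resolution a (N : {vspace fmod a}) (F : free_seq a) : Prop :=
  [/\ forall k, aug F k \in fdeg a (nth 0%N (shifts F 0) k),
      forall i k,
        dif F i k \in fdeg (shifts F i) (nth 0%N (shifts F i.+1) k),
      limg (linfun (fhom (aug F))) = N,
      limg (linfun (fhom (dif F 0%N))) = lker (linfun (fhom (aug F)))
    & forall i, limg (linfun (fhom (dif F i.+1))) =
                lker (linfun (fhom (dif F i)))].

Section Tor.
Variables (a : seq nat) (F : free_seq a).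

(* The matrix (acting on row vectors) of the differential                     *)
(* K (x)_E F_(i+1) -> K (x)_E F_i: only the constant terms survive.           *)
Definition tor_mx i : 'M[K]_(size (shifts F i.+1), size (shifts F i)) :=
  \matrix_(k, l) dif F i k l set0.

Definition tor_deg i (j : nat) : 'M[K]_(size (shifts F i)) :=
  diag_mx (\row_k (nth 0%N (shifts F i) k == j)%:R).

Definition tor_cycles i : nat -> 'M[K]_(size (shifts F i)) :=
  match i with
  | 0 => fun j => tor_deg 0 j
  | i'.+1 => fun j => (kermx (tor_mx i') :&: tor_deg i'.+1 j)%MS
  end.

Definition tor_boundaries i j : 'M[K]_(size (shifts F i)) :=
  (tor_mx i :&: tor_deg i j)%MS.

Definition tor_dim i j : nat :=
  (\rank (tor_cycles i j) - \rank (tor_boundaries i j))%N.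

End Tor.

(* The resolution used to define Tor: F_0 = E (x)_K N, with the E-basis given *)
(* by K-bases of the homogeneous components of N (all of them live in degrees *)
(* at most n + max a), and F_(i+1) is built likewise from the kernel of the   *)
(* map out of F_i; see std_resP.                                              *)
Definition std_gens a (N : {vspace fmod a}) : seq (nat * fmod a) :=
  [seq (j, v) | j <- iota 0 (n + \max_(x <- a) x).+1,
                v <- vbasis (N :&: fdeg a j)%VS].

Definition std_map a (N : {vspace fmod a})
  (k : 'I_(size (unzip1 (std_gens N)))) : fmod a :=
  (nth (0%N, 0) (std_gens N) k).2.

Definition std_syz (M : {a & {vspace fmod a}}) : {a & {vspace fmod a}} :=
  existT (fun a => {vspace fmod a}) (unzip1 (std_gens (tagged M)))
    (lker (linfun (fhom (@std_map _ (tagged M))))).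

Definition std_kernel a (N : {vspace fmod a}) (i : nat) :=
  iter i std_syz (existT (fun a => {vspace fmod a}) a N).

Definition std_res a (N : {vspace fmod a}) : free_seq a :=
  @FreeSeq a (fun i => tag (std_kernel N i.+1)) (@std_map a N)
    (fun i => @std_map _ (tagged (std_kernel N i.+1))).

Definition fcoord a (k : 'I_(size a)) (f : fmod a) : E := f k.

Fact fcoord_is_linear a k : linear (@fcoord a k).
Proof. by move=> c f g; rewrite /fcoord !ffunE. Qed.

HB.instance Definition _ a k :=
  GRing.isSemilinear.Build K (fmod a) E _ (@fcoord a k)
  (GRing.semilinear_linear (@fcoord_is_linear a k)).

(* I as a submodule of the free module E = E(0) of rank one.                  *)
Definition ideal_fmod (I : {vspace E}) : {vspace fmod [:: 0%N]} :=
  (linfun (@fcoord [:: 0%N] ord0) @^-1: I)%VS.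

(* dim_K Tor_i^E(I, K)_j, for a graded ideal I.                               *)
Definition betti (I : {vspace E}) (i j : nat) : nat :=
  tor_dim (std_res (ideal_fmod I)) i j.

Lemma fproj_id a j (f : fmod a) : fproj j (fproj j f) = fproj j f.
Proof. by apply/ffunP=> k; apply/ffunP=> S; rewrite !ffunE; case: eqP. Qed.

Lemma mem_fdeg a j (f : fmod a) : (f \in fdeg a j) = (fproj j f == f).
Proof.
apply/memv_imgP/eqP => [[g _ ->]|eqf]; first by rewrite lfunE /= fproj_id.
by exists f; rewrite ?memvf // lfunE.
Qed.

Lemma fdeg_coord a j (f : fmod a) (k : 'I_(size a)) (S : {set 'I_n}) :
  f \in fdeg a j -> (#|S| + nth 0 a k != j)%N -> f k S = 0.
Proof. by rewrite mem_fdeg => /eqP <- /negPf nj; rewrite !ffunE nj. Qed.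

Lemma sum_fproj a (f : fmod a) :
  f = \sum_(j <- iota 0 (n + \max_(x <- a) x).+1) fproj j f.
Proof.
apply/ffunP=> k; apply/ffunP=> S; rewrite !sum_ffunE.
pose j0 := (#|S| + nth 0 a k)%N.
have le_j0 : (j0 <= n + \max_(x <- a) x)%N.
  rewrite leq_add //; first by rewrite (leq_trans (max_card _)) ?card_ord.
  by rewrite (leq_bigmax_seq (F := id)) ?mem_nth.
rewrite (bigD1_seq j0) ?iota_uniq ?mem_iota //= big1 => [|j nj].
  by rewrite addr0 !ffunE eqxx.
by rewrite !ffunE eq_sym (negPf nj).
Qed.

Lemma fhom_scale b a (D : 'I_(size b) -> fmod a) x f :
  fhom D (fscale x f) = fscale x (fhom D f).
Proof.
apply/ffunP=> l; rewrite !ffunE mulr_sumr.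
by apply: eq_bigr => k _; rewrite ffunE mulrA.
Qed.

Lemma fhom_fproj b a (D : 'I_(size b) -> fmod a) j f :
  (forall k, D k \in fdeg a (nth 0%N b k)) ->
  fhom D (fproj j f) = fproj j (fhom D f).
Proof.
move=> Dhom; apply/ffunP=> l; apply/ffunP=> U; rewrite !ffunE !sum_ffunE.
transitivity (\sum_k if (#|U| + nth 0 a l == j)%N then (f k * D k l) U else 0);
  last by case: ifP => _ //; rewrite big1.
apply: eq_bigr => k _; rewrite !ext_mulE.
transitivity (\sum_(S : {set 'I_n} | S \subset U)
   if (#|U| + nth 0 a l == j)%N then
     (-1) ^+ ext_inv S (U :\: S) * (f k S * D k l (U :\: S)) else 0);
  last by case: ifP => _ //; rewrite big1.
apply: eq_bigr => S sSU; rewrite !ffunE.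
have [degD|nD] := eqVneq (#|U :\: S| + nth 0 a l)%N (nth 0 b k).
  have -> : (#|S| + nth 0 b k = #|U| + nth 0 a l)%N.
    by rewrite -degD addnA -(cardsID S U) (setIidPr sSU).
  by case: ifP; rewrite // mul0r mulr0.
by rewrite (fdeg_coord (Dhom k) nD) !mulr0 if_same.
Qed.

Definition fbase b (k : 'I_(size b)) : fmod b := [ffun l => (l == k)%:R].

Lemma fhom_base b a (D : 'I_(size b) -> fmod a) k : fhom D (fbase k) = D k.
Proof.
apply/ffunP=> l; rewrite ffunE (bigD1 k) //= big1 => [|k' nk].
  by rewrite ffunE eqxx mul1r addr0.
by rewrite ffunE (negPf nk) mul0r.
Qed.

Lemma fhomE b a (D : 'I_(size b) -> fmod a) f :
  fhom D f = \sum_k fscale (f k) (D k).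
Proof.
by apply/ffunP=> l; rewrite sum_ffunE ffunE; apply: eq_bigr => k _; rewrite ffunE.
Qed.

Lemma std_gensP a (N : {vspace fmod a}) (j : nat) (v : fmod a) :
  (j, v) \in std_gens N -> v \in N /\ v \in fdeg a j.
Proof.
case/allpairsPdep => j' [v' [_ v'in [-> ->]]].
by apply/andP; rewrite -memv_cap vbasis_mem.
Qed.

Lemma std_mapP a (N : {vspace fmod a}) k : @std_map a N k \in N /\
  @std_map a N k \in fdeg a (nth 0%N (unzip1 (std_gens N)) k).
Proof.
have lt_k : (k < size (std_gens N))%N by rewrite -(size_map fst) ltn_ord.
apply: std_gensP; rewrite (nth_map (0%N, 0)) // /std_map.
by rewrite -surjective_pairing mem_nth.
Qed.

Lemma limg_std_map a (N : {vspace fmod a}) :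
  graded_submod N -> limg (linfun (fhom (@std_map a N))) = N.
Proof.
case=> stabN projN; apply/vspaceP => f; apply/idP/idP.
  case/memv_imgP => g _ ->; rewrite lfunE /= fhomE memv_suml // => k _.
  by apply: stabN; have [] := std_mapP k.
move=> Nf; rewrite [f]sum_fproj big_seq memv_suml // => j j_in.
have Nj : fproj j f \in (N :&: fdeg a j)%VS.
  by rewrite memv_cap projN // mem_fdeg fproj_id eqxx.
suff sub : (N :&: fdeg a j <= limg (linfun (fhom (@std_map a N))))%VS.
  exact: (subvP sub).
rewrite -(span_basis (vbasisP (N :&: fdeg a j)%VS)); apply/span_subvP => v vin.
have gv : (j, v) \in std_gens N by apply/allpairsPdep; exists j, v.
have lt_i : (index (j, v) (std_gens N) < size (unzip1 (std_gens N)))%N.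
  by rewrite size_map index_mem.
apply/memv_imgP; exists (fbase (Ordinal lt_i)); rewrite ?memvf //.
by rewrite lfunE /= fhom_base /std_map nth_index.
Qed.

Lemma lker_graded b a (D : 'I_(size b) -> fmod a) :
  (forall k, D k \in fdeg a (nth 0%N b k)) ->
  graded_submod (lker (linfun (fhom D))).
Proof.
move=> Dhom; split=> [x f|j f]; rewrite !memv_ker !lfunE /= => /eqP f0.
  by rewrite fhom_scale f0; apply/eqP/ffunP=> l; rewrite !ffunE mulr0.
by rewrite fhom_fproj // f0 linear0.
Qed.

Lemma std_resP a (N : {vspace fmod a}) :
  graded_submod N -> free_resolution N (std_res N).
Proof.
move=> grN; split=> [k|i k|||i] /=; try by have [] := std_mapP k.
- exact: limg_std_map.
- by apply/limg_std_map/lker_graded => k; have [] := std_mapP k.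
by apply/limg_std_map/lker_graded => k; have [] := std_mapP k.
Qed.

Lemma ideal_gen_graded A : graded_submod (ideal_fmod (ideal_gen K A)).
Proof.
split=> [x f|j f]; rewrite /ideal_fmod -!memv_preim !lfunE /= /fcoord !mem_ideal_gen.
  move=> /forallP fA; apply/forallP => S; apply/implyP; apply: contraR => nA.
  rewrite ffunE ext_mulE big1 // => T sTS.
  suff -> : f ord0 (S :\: T) = 0 by rewrite !mulr0.
  apply/eqP; apply: contraNT nA => /(implyP (fA _)) /existsP[V /andP[AV sV]].
  by apply/existsP; exists V; rewrite AV (subset_trans sV) ?subsetDl.
move=> /forallP fA; apply/forallP => S; apply/implyP; rewrite !ffunE.
by case: ifP => _; [apply/implyP | rewrite eqxx].
Qed.

End FreeModules.

(* Main.v *)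
Require Import Defs.
From HB Require Import structures.
From mathcomp Require Import all_boot all_order all_algebra all_field.
From mathcomp Require Import mpoly zify.

(* The Betti numbers of I are computed from its Cartan complex, whose i-th    *)
(* term is the tensor product of I with the divided power D_i of the span of  *)
(* the e_k: dimension shifting along the standard resolution identifies       *)
(* Tor_i(I, K) with the i-th Cartan homology, since free modules are acyclic  *)
(* (contract against one e_k at a time).                                      *)
(* Order the generators of I by degree, and within a degree so that replacing *)
(* e_y by e_x with x < y moves a generator earlier. Then I has linear         *)
(* quotients: the colon ideal of a generator u by its predecessors is         *)
(* generated by a set L u of variables, namely those of u and the e_k,        *)
(* k < m(u), lying in none of the intervals [i_h, i_h + t_h), where           *)
(* i_1 < i_2 < ... is the support of u. As i_(h+1) - i_h is at least t_h, L u *)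
(* has m(u) - sum_h (t_h - 1) elements.                                       *)
(* The same contractions, along the variables outside L u, show that adding u *)
(* to its predecessors creates exactly the homology classes of e_u x^(m) with *)
(* m a divided power monomial in the variables of L u; no homology is killed, *)
(* because in the relevant degree the complex of the predecessors is exact.   *)

Set Implicit Arguments.
Unset Strict Implicit.
Unset Printing Implicit Defensive.

Import GRing.Theory.
Local Open Scope ring_scope.

(** * The Cartan complex *)

(** Three facts combine. Tor is balanced: [tor_dim_std_res] reads it off the Cartan complex instead
    of the standard resolution. Free modules have Cartan homology only at place 0 ([free_exact]), so
    the long exact sequence of each syzygy shifts the homology by one place ([hdim_connecting],
    [hdim_shift]). For generators [us] with linear quotients, [hdim_step] adds one generator [u] at
    a time. The new classes sit at place [i] in degree [i + #|u|], one for each divided power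
    monomial of degree [i] in the variables of [L u]. They cancel nothing, since the generators
    before [u] have size at most [#|u|] and so their complex is exact at place [i] in all degrees
    above [i + #|u|] ([exact_above]). Strong stability provides linear quotients
    ([linear_quotients_sorted_gens]). Moving one element of [u] down puts every variable of
    [colon_vars u] outside [u] into the colon ideal; comparing elements position by position
    ([nbelow_colon], [stable_le]) shows that there are no others. The binomial is then
    [card_supp_in] applied to [card_colon_vars]. *)

Section Contraction.
Variables (K : fieldType) (n : nat).
Local Notation E := (ext K n).
Implicit Types (S T : {set 'I_n}) (x y : E) (k l : 'I_n).

(** The sign in e_k e_S = ± e_(k |: S), for k outside S. *)
Definition wedge_sgn k S : K := (-1) ^+ ext_inv [set k] S.

Lemma wedge_sgn_mul k S : wedge_sgn k S * wedge_sgn k S = 1.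
Proof. by rewrite /wedge_sgn -exprD addnn -mul2n exprM sqrrN !expr1n. Qed.

Lemma wedge_sgnU1 k l S : l \notin S ->
  wedge_sgn k (l |: S) = (-1) ^+ (l < k)%N * wedge_sgn k S.
Proof.
move=> nlS; rewrite /wedge_sgn ext_invUr ?disjoints1 // exprD;
  congr (_ ^+ _ * _).
by rewrite /ext_inv !big_set1.
Qed.

Lemma emon1_mulE k x T : (emon K [set k] * x) T =
  if k \in T then wedge_sgn k (T :\ k) * x (T :\ k) else 0.
Proof.
rewrite ext_mulE; case: ifP => kT; last first.
  rewrite big1 // => S sST; rewrite ffunE.
  case: eqP => [eS|]; last by rewrite mul0r mulr0.
  by rewrite eS sub1set kT in sST.
rewrite (bigD1 [set k]) ?sub1set //= big1 => [|S /andP[_ /negPf nS]].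
  by rewrite ffunE eqxx mul1r addr0.
by rewrite ffunE nS mul0r mulr0.
Qed.

(** The interior product with the dual of e_k, that is, the left derivative along e_k. With
    multiplication by the e_l it satisfies the Clifford relations proved below, which make it the
    source of all homotopies. *)
Definition contract k x : E :=
  [ffun S : {set 'I_n} => if k \in S then 0 else wedge_sgn k S * x (k |: S)].

Lemma contractE k x S :
  contract k x S = if k \in S then 0 else wedge_sgn k S * x (k |: S).
Proof. by rewrite ffunE. Qed.

Fact contract_is_linear k : linear (contract k).
Proof.
move=> c x y; apply/ffunP => S; rewrite !ffunE; case: ifP => _.
  by rewrite scaler0 addr0.
by rewrite mulrDr; congr (_ + _); rewrite /GRing.scale /= mulrCA.
Qed.

HB.instance Definition _ k := GRing.isSemilinear.Build K E E _ (contract k)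
  (GRing.semilinear_linear (contract_is_linear k)).

Lemma emon1_mul_contract k x T :
  (emon K [set k] * contract k x) T = if k \in T then x T else 0.
Proof.
rewrite emon1_mulE; case: ifP => // kT.
by rewrite ffunE !inE eqxx /= mulrA wedge_sgn_mul mul1r setD1K.
Qed.

Lemma contract_emon1_mul k x T :
  contract k (emon K [set k] * x) T = if k \in T then 0 else x T.
Proof.
rewrite ffunE; case: ifP => // kT.
by rewrite emon1_mulE setU11 setU1K ?kT // mulrA wedge_sgn_mul mul1r.
Qed.

Lemma contract_anticomm k l x : k != l ->
  emon K [set l] * contract k x = - contract k (emon K [set l] * x).
Proof.
move=> nkl; apply/ffunP => T; rewrite emon1_mulE [RHS]ffunE !contractE
  emon1_mulE !inE.
rewrite [l == k]eq_sym (negPf nkl) /=.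
have [lT|] := boolP (l \in T); last by rewrite mulr0 if_same oppr0.
have [kT|kT] := boolP (k \in T); first by rewrite mulr0 oppr0.
have -> : (k |: T) :\ l = k |: (T :\ l).
  by apply/setP=> i; rewrite !inE; case: (eqVneq i k) => [->|];
    rewrite ?nkl ?andbF.
have -> : wedge_sgn k T = (-1) ^+ (l < k)%N * wedge_sgn k (T :\ l).
  by rewrite -{1}(setD1K lT) wedge_sgnU1 ?inE ?eqxx.
rewrite wedge_sgnU1 ?inE ?(negPf kT) ?andbF //.
case: (ltngtP k l) nkl => [||/val_inj->]; rewrite ?eqxx // => _ _;
  by rewrite expr0 expr1 !mul1r !mulN1r ?mulNr ?mulrN opprK mulrCA.
Qed.

Lemma emon1_anticomm k l x :
  emon K [set k] * (emon K [set l] * x) =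
    - (emon K [set l] * (emon K [set k] * x)).
Proof.
rewrite !mulrA -mulNr; congr (_ * _);
  rewrite !emon_mul !disjoints1 !inE [l == k]eq_sym.
have [_|nkl] := boolP (k == l); first by rewrite oppr0.
rewrite setUC /= -scaleNr; congr (_ *: _); rewrite /ext_inv !big_set1.
have [||] := ltngtP k l; rewrite ?expr0 ?expr1 ?opprK //.
by move=> /val_inj/eqP; rewrite (negPf nkl).
Qed.

Lemma emon1_sq k x : emon K [set k] * (emon K [set k] * x) = 0.
Proof. by rewrite mulrA emon_mul disjoints1 inE eqxx mul0r. Qed.

End Contraction.

(** * The Cartan differential and its homotopies *)

Section CartanComplex.
Variables (K : fieldType) (n b : nat).
Local Notation E := (ext K n).

Definition fwedge a (k : 'I_n) (f : fmod K n a) : fmod K n a :=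
  fscale (emon K [set k]) f.

Definition fcontract a (k : 'I_n) (f : fmod K n a) : fmod K n a :=
  [ffun l => contract k (f l)].

Fact fwedge_is_linear a k : linear (@fwedge a k).
Proof. by move=> c x y; apply/ffunP => l; rewrite !ffunE mulrDr scalerAr. Qed.

HB.instance Definition _ a k :=
  GRing.isSemilinear.Build K (fmod K n a) (fmod K n a) _ (@fwedge a k)
  (GRing.semilinear_linear (@fwedge_is_linear a k)).

Fact fcontract_is_linear a k : linear (@fcontract a k).
Proof. by move=> c x y; apply/ffunP => l; rewrite !ffunE linearP. Qed.

HB.instance Definition _ a k :=
  GRing.isSemilinear.Build K (fmod K n a) (fmod K n a) _ (@fcontract a k)
  (GRing.semilinear_linear (@fcontract_is_linear a k)).

Lemma fwedge_coord a k (f : fmod K n a) l : fwedge k f l = emon K [set k] * f l.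
Proof. by rewrite ffunE. Qed.

Lemma fcontract_coord a k (f : fmod K n a) l :
  fcontract k f l = contract k (f l).
Proof. by rewrite ffunE. Qed.

Lemma fwedgeE a k (f : fmod K n a) l T : fwedge k f l T =
  if k \in T then wedge_sgn K k (T :\ k) * f l (T :\ k) else 0.
Proof. by rewrite fwedge_coord emon1_mulE. Qed.

Lemma fcontractE a k (f : fmod K n a) l T : fcontract k f l T =
  if k \in T then 0 else wedge_sgn K k T * f l (k |: T).
Proof. by rewrite fcontract_coord contractE. Qed.

Lemma fwedge_contract a k (f : fmod K n a) l T :
  fwedge k (fcontract k f) l T = if k \in T then f l T else 0.
Proof. by rewrite fwedge_coord fcontract_coord emon1_mul_contract. Qed.

Lemma fcontract_wedge a k (f : fmod K n a) :
  fcontract k (fwedge k f) = f - fwedge k (fcontract k f).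
Proof.
apply/ffunP => l; apply/ffunP => T.
transitivity (f l T - fwedge k (fcontract k f) l T); last by rewrite !ffunE.
rewrite fwedge_contract fcontract_coord fwedge_coord contract_emon1_mul.
by case: ifP; rewrite ?subrr ?subr0.
Qed.

Lemma fcontract_anticomm a k k' (f : fmod K n a) : k != k' ->
  fwedge k' (fcontract k f) = - fcontract k (fwedge k' f).
Proof.
move=> nk; apply/ffunP => l; rewrite [RHS]ffunE fwedge_coord !fcontract_coord.
by rewrite fwedge_coord contract_anticomm.
Qed.

Lemma fwedge_anticomm a k k' (f : fmod K n a) :
  fwedge k (fwedge k' f) = - fwedge k' (fwedge k f).
Proof.
by apply/ffunP => l; rewrite [RHS]ffunE !fwedge_coord emon1_anticomm.
Qed.

Lemma fwedge_sq a k (f : fmod K n a) : fwedge k (fwedge k f) = 0.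
Proof. by apply/ffunP => l; rewrite !fwedge_coord emon1_sq ffunE. Qed.

Local Notation cartan a := {ffun 'X_{1..n < b} -> fmod K n a}.

(* Exponents are bounded by degree < b to keep the complex finite             *)
(* dimensional, so exactness can only hold in degrees well below b.           *)
Definition ccoef a (m : 'X_{1..n}) (F : cartan a) : fmod K n a :=
  oapp F 0 (insub m).

Lemma ccoef_val a (F : cartan a) (m : 'X_{1..n < b}) : ccoef m F = F m.
Proof. by rewrite /ccoef valK. Qed.

Lemma ccoef_out a (F : cartan a) (m : 'X_{1..n}) :
  (b <= mdeg m)%N -> ccoef m F = 0.
Proof. by move=> bm; rewrite /ccoef insubN // -leqNgt. Qed.

Lemma cartanP a (F G : cartan a) : (forall m, ccoef m F = ccoef m G) -> F = G.
Proof. by move=> eFG; apply/ffunP => m; rewrite -!ccoef_val. Qed.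

Lemma ccoef_ffun a (g : 'X_{1..n} -> fmod K n a) m :
  ccoef m [ffun m : 'X_{1..n < b} => g m] = if (mdeg m < b)%N then g m else 0.
Proof. by rewrite /ccoef; case: insubP => [m' -> <-|/negPf->] //=;
  rewrite ffunE. Qed.

Fact ccoef_is_linear a m : linear (@ccoef a m).
Proof.
move=> c F G; rewrite /ccoef; case: insubP => [m' _ _|_] /=;
  first by rewrite !ffunE.
by rewrite scaler0 addr0.
Qed.

HB.instance Definition _ a m :=
  GRing.isSemilinear.Build K (cartan a) (fmod K n a) _ (@ccoef a m)
  (GRing.semilinear_linear (@ccoef_is_linear a m)).

Lemma ccoefB a (F G : cartan a) m : ccoef m (F - G) = ccoef m F - ccoef m G.
Proof. exact: (linearB (@ccoef a m)). Qed.

Lemma ccoefD a (F G : cartan a) m : ccoef m (F + G) = ccoef m F + ccoef m G.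
Proof. exact: (linearD (@ccoef a m)). Qed.

Lemma ccoef0 a m : ccoef m (0 : cartan a) = 0.
Proof. exact: (linear0 (@ccoef a m)). Qed.

(** Reading [F] as the sum of the F_m x^(m), this sends f x^(m) to the sum of the e_k f x^(m - U_k).
    With divided powers no integer coefficients appear, so the characteristic does not matter. *)
Definition cartan_d a (F : cartan a) : cartan a :=
  [ffun m : 'X_{1..n < b} => \sum_k fwedge k (ccoef (m + U_(k))%MM F)].

Lemma ccoef_cartan_d a (F : cartan a) m :
  ccoef m (cartan_d F) = \sum_k fwedge k (ccoef (m + U_(k))%MM F).
Proof.
rewrite (ccoef_ffun (fun m => \sum_k fwedge k (ccoef (m + U_(k))%MM F))).
case: ltnP => // bm; rewrite big1 // => k _.
by rewrite ccoef_out ?linear0 // mdegD (leq_trans bm) ?leq_addr.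
Qed.

Fact cartan_d_is_linear a : linear (@cartan_d a).
Proof.
move=> c F G; apply: cartanP => m;
  rewrite linearP /= !ccoef_cartan_d scaler_sumr.
rewrite -big_split /=; apply: eq_bigr => k _.
by rewrite (linearP (@ccoef a _)) /= linearP.
Qed.

HB.instance Definition _ a :=
  GRing.isSemilinear.Build K (cartan a) (cartan a) _ (@cartan_d a)
  (GRing.semilinear_linear (@cartan_d_is_linear a)).

(** The vanishing diagonal is a separate hypothesis because antisymmetry does not imply it in
    characteristic 2. *)
Lemma sum_antisym (V : zmodType) (p : nat) (G : 'I_p -> 'I_p -> V) :
  (forall k, G k k = 0) -> (forall k l, G k l = - G l k) ->
  \sum_k \sum_l G k l = 0.
Proof.
elim: p G => [|p IH] G G0 GN; first by rewrite big_ord0.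
rewrite big_ord_recl [X in X + _]big_ord_recl G0 add0r.
under [X in _ + X]eq_bigr => k _ do rewrite big_ord_recl.
rewrite big_split /= (IH (fun k l => G (lift ord0 k) (lift ord0 l))) //.
by rewrite addr0 -big_split big1 //= => k _; rewrite GN addNr.
Qed.

Lemma cartan_d_sq a (F : cartan a) : cartan_d (cartan_d F) = 0.
Proof.
apply: cartanP => m; rewrite ccoef0 ccoef_cartan_d.
under eq_bigr => k _ do rewrite ccoef_cartan_d linear_sum.
apply: sum_antisym => [k|k l]; first exact: fwedge_sq.
by rewrite /= fwedge_anticomm -!addmA (addmC U_(k)%MM).
Qed.

(** Contracts e_k away and raises the divided power of x_k by one. *)
Definition homotopy a k (F : cartan a) : cartan a :=
  [ffun m : 'X_{1..n < b} =>
     if (0 < m k)%N then fcontract k (ccoef (m - U_(k))%MM F) else 0].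

Lemma ccoef_homotopy a k (F : cartan a) m :
  ccoef m (homotopy k F) = if (mdeg m < b)%N && (0 < m k)%N
    then fcontract k (ccoef (m - U_(k))%MM F) else 0.
Proof.
rewrite (ccoef_ffun (fun m =>
  if (0 < m k)%N then fcontract k (ccoef (m - U_(k))%MM F) else 0)).
by case: ifP.
Qed.

(** Where x_k occurs in [m] this is dh + hd = 1. Where it does not, hd has no such term and dh
    projects onto the monomials containing e_k. The bound keeps [m + U_(k)] inside the
    truncation. *)
Lemma cartan_d_homotopy a k (F : cartan a) m : ((mdeg m).+1 < b)%N ->
  ccoef m (cartan_d (homotopy k F)) =
    if m k == 0%N then fwedge k (fcontract k (ccoef m F))
    else ccoef m F - fcontract k (ccoef (m - U_(k))%MM (cartan_d F)).
Proof.
move=> mb; rewrite ccoef_cartan_d (bigD1 k) //=.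
rewrite ccoef_homotopy mdegD mdeg1 addn1 mb mnmDE mnm1E eqxx addn1 addmK /=.
have [m0|m0] := eqVneq (m k) 0%N.
  rewrite big1 ?addr0 // => l nlk.
  by rewrite ccoef_homotopy mnmDE mnm1E (negPf nlk) m0 andbF linear0.
have mU l : l != k -> (m + U_(l) - U_(k) = m - U_(k) + U_(l))%MM.
  move=> nlk; apply/mnmP => i; rewrite !(mnmBE, mnmDE, mnm1E).
  have [<-|_] := eqVneq k i; last by rewrite !subn0.
  by rewrite (negPf nlk) !addn0.
rewrite ccoef_cartan_d linear_sum [in RHS](bigD1 k) //= submK ?lep1mP //.
rewrite fcontract_wedge opprD opprB addrCA addrA addrNK -sumrN.
congr (_ + _); apply: eq_bigr => l nlk.
rewrite ccoef_homotopy mdegD mdeg1 addn1 mb mnmDE mnm1E (negPf nlk) addn0.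
by rewrite lt0n m0 /= mU // fcontract_anticomm // eq_sym.
Qed.

(** The coefficients allowed at place [i] in total degree [s], where each x_k has degree 1. The test
    [i <= s] keeps the truncated [s - i] from letting in degree 0. *)
Definition slot a (N : {vspace fmod K n a}) i s j : {vspace fmod K n a} :=
  (if (j == i) && (i <= s)%N then N :&: fdeg K n a (s - i) else 0)%VS.

Definition cartan_sub a (N : {vspace fmod K n a}) i s : {vspace cartan a} :=
  (\bigcap_(m : 'X_{1..n < b}) (linfun (ccoef m) @^-1: slot N i s (mdeg m)))%VS.

Lemma mem_cartan_sub a (N : {vspace fmod K n a}) i s F :
  F \in cartan_sub N i s <-> forall m, ccoef m F \in slot N i s (mdeg m).
Proof.
rewrite memvE; split=> [/subv_bigcapP FN m|FN].
  have [mb|bm] := ltnP (mdeg m) b; last by rewrite ccoef_out ?mem0v.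
  by have := FN (BMultinom mb) isT; rewrite -memvE -memv_preim lfunE.
by apply/subv_bigcapP => m _; rewrite -memvE -memv_preim lfunE /=.
Qed.

End CartanComplex.

(** * Cartan complexes of graded and monomial submodules *)

Section CartanSub.
Variables (K : fieldType) (n b : nat).
Local Notation fmod := (fmod K n).
Local Notation cartan a := {ffun 'X_{1..n < b} -> fmod a}.

Lemma mem_fdegP a q (f : fmod a) :
  f \in fdeg K n a q <-> forall l S, f l S != 0 -> (#|S| + nth 0%N a l = q)%N.
Proof.
split=> [fq l S|fq].
  by apply: contraNeq => nq; rewrite (fdeg_coord fq).
rewrite mem_fdeg; apply/eqP/ffunP => l; apply/ffunP => S; rewrite !ffunE.
by case: eqP => // nq; apply/esym/eqP; apply: contraPT nq => /fq ->.
Qed.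

Lemma mem_cartan_subP a (N : {vspace fmod a}) i s (F : cartan a) :
  F \in cartan_sub b N i s <->
  (forall m, ccoef m F \in N) /\
  (forall m l S, ccoef m F l S != 0 ->
     mdeg m = i /\ (i + (#|S| + nth 0 a l) = s)%N).
Proof.
rewrite mem_cartan_sub; split=> [FN|[FN Fs] m].
  split=> m; have := FN m; rewrite /slot; case: ifP => [/andP[/eqP mi le_is]|_].
  - by rewrite memv_cap => /andP[].
  - by rewrite memv0 => /eqP->; rewrite mem0v.
  - rewrite memv_cap => /andP[_ /mem_fdegP Fd] l S /Fd->; split=> //.
    by rewrite subnKC.
  by rewrite memv0 => /eqP-> l S; rewrite !ffunE eqxx.
have [->|nz] := eqVneq (ccoef m F) 0; first exact: mem0v.
have /existsP[l /existsP[S /Fs[-> defs]]] :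
    [exists l, exists S, ccoef m F l S != 0].
  apply: contraNT nz => /existsPn F0; apply/eqP/ffunP => l; apply/ffunP => S.
  by have /existsPn/(_ S)/negbNE/eqP -> := F0 l; rewrite !ffunE.
rewrite /slot -defs eqxx leq_addr /= memv_cap FN /= addKn;
  apply/mem_fdegP => l' S'.
by case/Fs=> _; rewrite -defs => /addnI.
Qed.

Lemma cartan_subS a (N N' : {vspace fmod a}) i s :
  (N <= N')%VS -> (cartan_sub b N i s <= cartan_sub b N' i s)%VS.
Proof.
move=> /subvP sNN; apply/subvP => F /mem_cartan_subP[FN Fs].
by apply/mem_cartan_subP; split=> // m; apply: sNN.
Qed.

Lemma cartan_d_ccoef a (N : {vspace fmod a}) (F : cartan a) :
  graded_submod N -> (forall m, ccoef m F \in N) ->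
  forall m, ccoef m (cartan_d F) \in N.
Proof.
move=> [stabN _] FN m; rewrite ccoef_cartan_d; apply: memv_suml => k _.
exact: stabN.
Qed.

Lemma cartan_d_sub a (N : {vspace fmod a}) i s (F : cartan a) :
  graded_submod N -> F \in cartan_sub b N i.+1 s ->
  cartan_d F \in cartan_sub b N i s.
Proof.
move=> grN /mem_cartan_subP[FN Fs]; apply/mem_cartan_subP; split.
  exact: cartan_d_ccoef.
move=> m l S; rewrite ccoef_cartan_d sum_ffunE sum_ffunE => nz.
have /existsP[k] : [exists k, fwedge k (ccoef (m + U_(k))%MM F) l S != 0].
  apply: contraNT nz => /existsPn F0; rewrite big1 // => k _.
  by have /negbNE/eqP := F0 k.
rewrite fwedgeE; case: ifP => [kS|]; last by rewrite eqxx.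
rewrite mulf_eq0 negb_or => /andP[_ /Fs[]];
  rewrite mdegD mdeg1 addn1 => -[->] <-.
by split=> //; rewrite [in LHS](cardsD1 k S) kS addSnnS.
Qed.

Lemma cartan_d_limg a (N : {vspace fmod a}) i s :
  graded_submod N ->
  (linfun (@cartan_d K n b a) @: cartan_sub b N i.+1 s <=
    cartan_sub b N i s)%VS.
Proof.
move=> grN; apply/subvP => _ /memv_imgP[F FN ->]; rewrite lfunE /=.
exact: cartan_d_sub.
Qed.

Lemma fullv_graded a : graded_submod (fullv : {vspace fmod a}).
Proof. by split=> *; apply: memvf. Qed.

Definition fmask a (J : pred {set 'I_n}) (f : fmod a) : fmod a :=
  [ffun l => [ffun S => if J S then f l S else 0] : ext K n].

Fact fmask_is_linear a J : linear (@fmask a J).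
Proof.
move=> c f g; apply/ffunP => l; apply/ffunP => S; rewrite !ffunE.
by case: ifP; rewrite // scaler0 addr0.
Qed.

HB.instance Definition _ a J :=
  GRing.isSemilinear.Build K (fmod a) (fmod a) _ (@fmask a J)
  (GRing.semilinear_linear (@fmask_is_linear a J)).

Lemma fmaskE a J (f : fmod a) l S : fmask J f l S = if J S then f l S else 0.
Proof. by rewrite !ffunE. Qed.

(** For [J] closed under supersets and [a = [:: 0]], the monomial ideal whose monomials are the e_S
    with [J S]. *)
Definition monsub a (J : pred {set 'I_n}) : {vspace fmod a} :=
  limg (linfun (@fmask a J)).

Lemma mem_monsub a (J : pred {set 'I_n}) (f : fmod a) :
  f \in monsub a J <-> forall l S, f l S != 0 -> J S.
Proof.
split=> [/memv_imgP[g _ ->] l S|fJ].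
  by rewrite lfunE fmaskE; case: ifP; rewrite ?eqxx.
apply/memv_imgP; exists f; rewrite ?memvf // lfunE.
apply/ffunP => l; apply/ffunP => S; rewrite fmaskE; case: ifP => // nJ.
by apply/eqP; apply: contraFT nJ => /fJ.
Qed.

Lemma monsub_coord0 a (J : pred {set 'I_n}) (f : fmod a) l S :
  f \in monsub a J -> ~~ J S -> f l S = 0.
Proof. by move=> /mem_monsub fJ nJ; apply: contraNeq nJ => /fJ. Qed.

Lemma monsub_graded a (J : pred {set 'I_n}) :
  (forall S T : {set 'I_n}, S \subset T -> J S -> J T) ->
    graded_submod (monsub a J).
Proof.
move=> upJ; split=> [x f|j f] /mem_monsub fJ; apply/mem_monsub => l S.
  rewrite ffunE ext_mulE; apply: contraR => nJ; rewrite big1 // => T sTS.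
  suff -> : f l (S :\: T) = 0 by rewrite !mulr0.
  apply/eqP; apply: contraR nJ => /fJ; apply: upJ; exact: subsetDl.
by rewrite !ffunE; case: ifP; rewrite ?eqxx // => _ /fJ.
Qed.

(** * Contraction along the variables outside [L] *)

Section Reduction.
Variables (a : seq nat) (J U : pred {set 'I_n}) (u L : {set 'I_n}).
Hypotheses (upJ : forall S T : {set 'I_n}, S \subset T -> J S -> J T)
           (upU : forall S T : {set 'I_n}, S \subset T -> U S -> U T)
           (JP : forall S : {set 'I_n}, J S -> S :&: L != u)
           (UE : forall S : {set 'I_n}, U S = J S || (S :&: L == u)).

(** Modulo [J], the monomials of [U] are those with trace [u] on [L]. Inserting or removing k
    outside [L] leaves the trace unchanged, so [homotopy k] acts on this quotient, in which [F] is a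
    cycle. *)
Lemma homotopy_step i s (F : cartan a) k :
  (i.+1 < b)%N -> k \notin L -> F \in cartan_sub b (monsub a U) i s ->
  (forall m, ccoef m (cartan_d F) \in monsub a J) ->
  exists2 G, G \in cartan_sub b (monsub a U) i.+1 s &
    forall m l S, ~~ J S -> ccoef m (F - cartan_d G) l S =
      if (k \in S) || (0 < m k)%N then 0 else ccoef m F l S.
Proof.
move=> ib nkL FU dFJ; have [FU' Fs] := iffLR (mem_cartan_subP _ _ _ _) FU.
(* The terms in [J] are dropped first, since contracting them could lead out of [U]. The boundary
   still lies in [J], as [F - R] does. *)
pose R : cartan a := [ffun m => fmask (predC J) (F m)].
have coefR m : ccoef m R = fmask (predC J) (ccoef m F).
  rewrite /ccoef; case: insubP => [m' _ _|_] /=; first by rewrite ffunE.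
  by rewrite linear0.
have PkU S : (k |: S) :&: L = S :&: L.
  by apply/setP=> x; rewrite !inE; case: eqVneq => [->|//];
    rewrite (negPf nkL) !andbF.
have RP m l S : ccoef m R l S != 0 -> S :&: L == u.
  rewrite coefR fmaskE /=; case: ifP => [nJ nz|]; last by rewrite eqxx.
  by have := iffLR (mem_monsub _ _) (FU' m) l S nz; rewrite UE (negPf nJ).
pose G := homotopy k R.
have GU : G \in cartan_sub b (monsub a U) i.+1 s.
  apply/mem_cartan_subP; split=> [m|m l S].
    apply/mem_monsub => l S; rewrite ccoef_homotopy; case: ifP;
      last by rewrite !ffunE eqxx.
    move=> _; rewrite fcontractE; case: ifP; rewrite ?eqxx // => kS.
    rewrite mulf_eq0 negb_or => /andP[_ /RP]; rewrite PkU => PS.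
    by rewrite UE PS orbT.
  rewrite ccoef_homotopy; case: ifP; last by rewrite !ffunE eqxx.
  move=> /andP[_ mk]; rewrite fcontractE; case: ifP; rewrite ?eqxx // => kS.
  rewrite mulf_eq0 negb_or => /andP[_]; rewrite coefR fmaskE.
  case: ifP => _; last by rewrite eqxx.
  move=> /Fs[mi]; rewrite cardsU1 kS /= => <-; split; last by rewrite addSnnS.
  have /submK <- : (U_(k) <= m)%MM by rewrite lep1mP -lt0n.
  by rewrite mdegD mdeg1 mi addn1.
have dGU := cartan_d_sub (monsub_graded _ upU) GU.
exists G => // m l S nJ; have [US|nUS] := boolP (U S); last first.
  rewrite !(@monsub_coord0 _ U _ l S _ nUS) ?if_same //.
  have := memvB FU dGU.
  by move=> /mem_cartan_subP[].
have PS : S :&: L == u by move: US; rewrite UE (negPf nJ).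
have [mi|nmi] := eqVneq (mdeg m) i; last first.
  have F0 : forall H, H \in cartan_sub b (monsub a U) i s -> ccoef m H l S = 0.
    move=> H /mem_cartan_subP[_ Hs].
    by apply: contraNeq nmi => /Hs[->].
  by rewrite !F0 ?if_same // memvB.
have RS : ccoef m R l S = ccoef m F l S by rewrite coefR fmaskE /= nJ.
rewrite ccoefB cartan_d_homotopy ?mi //.
transitivity (ccoef m F l S -
  (if m k == 0%N then fwedge k (fcontract k (ccoef m R))
   else ccoef m R - fcontract k (ccoef (m - U_(k))%MM (cartan_d R))) l S).
  by rewrite !ffunE.
have [m0|m0] := eqVneq (m k) 0%N.
  by rewrite fwedge_contract RS m0 orbF; case: ifP; rewrite ?subrr ?subr0.
rewrite lt0n m0 orbT.
transitivity (fcontract k (ccoef (m - U_(k))%MM (cartan_d R)) l S).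
  rewrite -RS; set x := ccoef m R; set y := fcontract _ _.
  by rewrite !ffunE opprB addrC addrNK.
(* The hd term vanishes: it reads the boundary of [R], which lies in [J], at [k |: S], whose trace
   on [L] is still [u]. *)
rewrite fcontractE; case: ifP => // kS; rewrite (@monsub_coord0 _ J) ?mulr0 //.
  rewrite -[R](subrK F) -opprB linearD linearN /= ccoefD.
  rewrite memvD ?dFJ // -scaleN1r (linearZ_LR (@ccoef K n b a _)) memvZ //=.
  apply: cartan_d_ccoef; first exact: monsub_graded.
  move=> m'; apply/mem_monsub => l' S'; rewrite ccoefB coefR !ffunE /=.
  by case: ifP => [_|/negbFE //]; rewrite subrr eqxx.
by apply/negP => /JP; rewrite PkU PS.
Qed.

(** One [homotopy_step] for each k outside [L]. Every step keeps or kills each coefficient outside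
    [J], so nothing already removed comes back. Outside [J] only terms e_u x^(m) with m in the
    variables of [L] survive. *)
Lemma homotopy_reduce i s (F : cartan a) :
  (i.+1 < b)%N -> F \in cartan_sub b (monsub a U) i s ->
  (forall m, ccoef m (cartan_d F) \in monsub a J) ->
  exists2 G, G \in cartan_sub b (monsub a U) i.+1 s &
    forall m l S, ~~ J S -> ccoef m (F - cartan_d G) l S != 0 ->
      S = u /\ (forall k, k \notin L -> m k = 0%N).
Proof.
move=> ib FU dFJ.
suff [G GU GP] : exists2 G, G \in cartan_sub b (monsub a U) i.+1 s &
    forall m l S, ~~ J S -> ccoef m (F - cartan_d G) l S != 0 ->
      forall k, k \in enum (~: L) -> (k \notin S) && (m k == 0%N).
  exists G => // m l S nJ nz; have := GP m l S nJ nz => {}GP; split; last first.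
    move=> k kL; have kin : k \in enum (~: L) by rewrite mem_enum inE.
  by have /andP[_ /eqP] := GP k kin.
  have FG : F - cartan_d G \in cartan_sub b (monsub a U) i s.
    by rewrite memvB // cartan_d_sub //; apply: monsub_graded.
  have /mem_cartan_subP[/(_ m) FGU _] := FG.
  have := iffLR (mem_monsub _ _) FGU _ _ nz;
    rewrite UE (negPf nJ) /= => /eqP <-.
  apply/esym/setIidPl/subsetP => k kS; apply: contraLR kS => kL.
  have kin : k \in enum (~: L) by rewrite mem_enum inE.
  by have /andP[] := GP k kin.
have : {subset enum (~: L) <= [predC L]} by move=> k; rewrite mem_enum inE.
elim: (enum _) => [|k ks IH] ksL; first by exists 0; rewrite ?mem0v.
have [|G GU GP] := IH; first by move=> k' k'in; apply: ksL;
  rewrite inE k'in orbT.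
have FGU : F - cartan_d G \in cartan_sub b (monsub a U) i s.
  by rewrite memvB // cartan_d_sub //; apply: monsub_graded.
have [||H HU HP] := homotopy_step (k := k) ib _ FGU.
- by move/(_ k): ksL; rewrite inE eqxx => /(_ isT).
- by move=> m; rewrite linearB /= cartan_d_sq subr0.
exists (G + H) => [|m l S nJ]; first exact: memvD.
rewrite (linearD (@cartan_d K n b a)) opprD addrA HP //; case: ifP;
  rewrite ?eqxx // => /negbT.
rewrite negb_or lt0n negbK => kSm nz k'; rewrite inE => /predU1P[-> //|].
exact: (GP m l S nJ nz).
Qed.

End Reduction.

End CartanSub.

(** * Tor as Cartan homology *)

Section LinearAlgebra.
Variable K : fieldType.

(* The connecting isomorphism of a short exact sequence of complexes          *)
(* X -> Y -> Z, read on dimensions at a place where Y is exact; here          *)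
(* Z = p(Y) and X = Y :&: lker p.                                             *)
Lemma connecting_dim (V W : vectType K) (dV : 'End(V)) (dW : 'End(W))
    (p : 'Hom(V, W)) (Y0 Y1 Y2 : {vspace V}) :
  (forall v, p (dV v) = dW (p v)) ->
  (dV @: Y1 <= Y0)%VS -> (dV @: Y2 = Y1 :&: lker dV)%VS ->
  (\dim (p @: Y1 :&: lker dW) - \dim (dW @: (p @: Y2)) =
   \dim ((Y0 :&: lker p) :&: dV @: Y1) - \dim (dV @: (Y1 :&: lker p)))%N.
Proof.
move=> pd sdY eY2; pose Q := (Y1 :&: dV @^-1: lker p)%VS.
have QE v : (v \in Q) = (v \in Y1) && (dW (p v) == 0).
  by rewrite memv_cap -memv_preim memv_ker pd.
have pQ : (p @: Q = p @: Y1 :&: lker dW)%VS.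
  apply/vspaceP => w; rewrite memv_cap; apply/memv_imgP/andP => [[v]|[]].
    by rewrite QE => /andP[Yv dv0] ->; rewrite memv_img ?memv_ker.
  move=> /memv_imgP[v Yv ->]; rewrite memv_ker => dv0.
  by exists v; rewrite ?QE ?Yv.
have Qp : (Q :&: lker p = Y1 :&: lker p)%VS.
  apply/vspaceP => v; rewrite !memv_cap -memv_preim !memv_ker pd andbAC.
  by case: eqP => [->|]; rewrite ?linear0 ?eqxx ?andbF ?andbT.
have dQ : (dV @: Q = (Y0 :&: lker p) :&: dV @: Y1)%VS.
  apply/vspaceP => w; rewrite !memv_cap;
    apply/memv_imgP/andP => [[v]|[/andP[_ pw]]].
    rewrite QE -pd => /andP[Yv dv0] ->; rewrite memv_ker dv0 memv_img //.
    by rewrite (subvP sdY) ?memv_img.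
  move=> /memv_imgP[v Yv def_w]; exists v => //.
  by rewrite QE Yv -pd -def_w -memv_ker.
have Qd : (Q :&: lker dV = dV @: Y2)%VS.
  rewrite eY2; apply/vspaceP => v;
    rewrite !memv_cap -memv_preim !memv_ker andbAC.
  by case: eqP => [->|]; rewrite ?linear0 ?eqxx ?andbF ?andbT.
have dY2p : (dV @: Y2 :&: lker p = (Y1 :&: lker p) :&: lker dV)%VS.
  by rewrite eY2 -!capvA [(lker dV :&: _)%VS]capvC.
have pdY2 : (p @: (dV @: Y2) = dW @: (p @: Y2))%VS.
  by rewrite -!limg_comp; congr (_ @: _)%VS; apply/lfunP => v;
    rewrite !lfunE /= pd.
have := limg_ker_dim p Q; have := limg_ker_dim dV Q.
have := limg_ker_dim p (dV @: Y2); have := limg_ker_dim dV (Y1 :&: lker p).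
rewrite pQ Qp dQ Qd dY2p pdY2; lia.
Qed.

Lemma dim_row_space (m p : nat) (A : 'M[K]_(m, p)) (W : {vspace 'rV[K]_p}) :
  (forall v, (v \in W) = (v <= A)%MS) -> \dim W = \rank A.
Proof.
move=> WE; pose f := linfun (mulmxr (row_base A)) : 'Hom('rV[K]_(\rank A),
  'rV[K]_p).
have -> : W = limg f.
  apply/vspaceP => v; rewrite WE -(eq_row_base A).
  apply/submxP/memv_imgP => [[w ->]|[w _ ->]]; exists w;
    rewrite ?memvf ?lfunE //.
rewrite limg_dim_eq; first by rewrite dimvf /dim /= mul1n.
apply/eqP; rewrite -subv0; apply/subvP => w;
  rewrite memv_cap memvf memv_ker lfunE /=.
by rewrite mulmx_free_eq0 ?row_base_free // memv0.
Qed.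

End LinearAlgebra.

Section Tor.
Variables (K : fieldType) (n b : nat).
Local Notation fmod := (fmod K n).
Local Notation cartan a := {ffun 'X_{1..n < b} -> fmod a}.
Local Notation cs := (cartan_sub b).
Local Notation dl := (linfun (@cartan_d K n b _)).

Definition boundaries a (N : {vspace fmod a}) i s : {vspace cartan a} :=
  (dl @: cs N i.+1 s)%VS.

Definition hdim a (N : {vspace fmod a}) i s : nat :=
  (\dim (cs N i s :&: lker dl) - \dim (boundaries N i s))%N.

Lemma mem_monsubT a (f : fmod a) : f \in monsub K a predT.
Proof. exact/mem_monsub. Qed.

Lemma monsubT a : monsub K a (@predT {set 'I_n}) = fullv.
Proof. by apply/vspaceP => f; rewrite memvf mem_monsubT. Qed.

(** The case where [J] is empty, [U] is everything and [u = L = set0]: all variables are contracted,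
    and only constants can survive. *)
Lemma free_reduce a i s (F : cartan a) : (i.+1 < b)%N ->
  F \in cs fullv i s -> cartan_d F = 0 ->
  exists2 G, G \in cs fullv i.+1 s & forall m l S,
    ccoef m (F - cartan_d G) l S != 0 -> S = set0 /\ m = 0%MM.
Proof.
move=> ib FY dF0.
have [||||||G GY GP] := @homotopy_reduce K n b a pred0 predT set0 set0 _ _ _ _
  i s F ib.
- by [].
- by [].
- by [].
- by move=> S; rewrite setI0 eqxx.
- by rewrite monsubT.
- by move=> m; rewrite dF0 ccoef0 mem0v.
exists G; first by rewrite -monsubT.
move=> m l S /(GP m l S isT)[-> m0]; split=> //; apply/mnmP => k.
by rewrite m0 ?mnm0E ?inE.
Qed.

Lemma free_exact a i s : (i.+2 < b)%N ->
  boundaries (fullv : {vspace fmod a}) i.+1 s =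
    (cs fullv i.+1 s :&: lker dl)%VS.
Proof.
move=> ib; apply/vspaceP => F; rewrite memv_cap memv_ker lfunE /=.
apply/memv_imgP/andP => [[G GY ->]|[FY /eqP dF0]].
  by rewrite lfunE /= cartan_d_sq eqxx cartan_d_sub //; apply: fullv_graded.
have [G GY GP] := free_reduce ib FY dF0; exists G => //; rewrite lfunE.
apply/eqP; rewrite -subr_eq0; apply/eqP; apply: cartanP => m; rewrite ccoef0.
apply/ffunP => l; apply/ffunP => S; rewrite !ffunE; apply/eqP.
apply: contraT => nz; have [_ m0] := GP m l S nz.
have : F - cartan_d G \in cs fullv i.+1 s.
  by rewrite memvB // cartan_d_sub //; apply: fullv_graded.
by move=> /mem_cartan_subP[_ /(_ m l S nz)[]]; rewrite m0 mdeg0.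
Qed.

Lemma cartan_d0 a (N : {vspace fmod a}) s (F : cartan a) :
  F \in cs N 0 s -> cartan_d F = 0.
Proof.
move=> /mem_cartan_subP[_ Fs]; apply: cartanP => m;
  rewrite ccoef_cartan_d ccoef0.
rewrite big1 // => k _; suff -> : ccoef (m + U_(k))%MM F = 0 by rewrite linear0.
apply/ffunP => l; apply/ffunP => S; rewrite !ffunE; apply/eqP.
by apply: contraT => /Fs[]; rewrite mdegD mdeg1 addn1.
Qed.

Section ChainMap.
Variables (a c : seq nat) (D : 'I_(size c) -> fmod a).
Hypothesis Dhom : forall k, D k \in fdeg K n a (nth 0%N c k).

Definition cartan_map (F : cartan c) : cartan a :=
  [ffun m : 'X_{1..n < b} => fhom D (F m)].

Lemma ccoef_cartan_map F m : ccoef m (cartan_map F) = fhom D (ccoef m F).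
Proof.
rewrite /ccoef; case: insubP => [m' _ _|_] /=; first by rewrite ffunE.
by rewrite linear0.
Qed.

Fact cartan_map_is_linear : linear cartan_map.
Proof.
by move=> x F G; apply/ffunP => m; rewrite !ffunE linearP.
Qed.

HB.instance Definition _ :=
  GRing.isSemilinear.Build K (cartan c) (cartan a) _ cartan_map
  (GRing.semilinear_linear cartan_map_is_linear).

Lemma cartan_map_d F : cartan_map (cartan_d F) = cartan_d (cartan_map F).
Proof.
apply: cartanP => m; rewrite ccoef_cartan_map !ccoef_cartan_d linear_sum /=.
by apply: eq_bigr => k _; rewrite ccoef_cartan_map /fwedge fhom_scale.
Qed.

Local Notation p := (linfun cartan_map).
Local Notation N := (limg (linfun (fhom D))).
Local Notation X := (lker (linfun (fhom D))).

Lemma fhom_fdeg q f : f \in fdeg K n c q -> fhom D f \in fdeg K n a q.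
Proof. by rewrite !mem_fdeg -fhom_fproj // => /eqP->. Qed.

Lemma cartan_map_ker i s : (cs fullv i s :&: lker p = cs X i s)%VS.
Proof.
apply/vspaceP => F; rewrite memv_cap memv_ker lfunE /=; apply/andP/idP.
  move=> [/mem_cartan_subP[_ Fs] /eqP pF0]; apply/mem_cartan_subP; split=> // m.
  by rewrite memv_ker lfunE /= -ccoef_cartan_map pF0 ccoef0.
move=> FX; rewrite (subvP (cartan_subS _ _ _ (subvf _)) _ FX); split=> //.
apply/eqP; apply: cartanP => m; rewrite ccoef_cartan_map ccoef0.
by have /mem_cartan_subP[/(_ m)] := FX; rewrite memv_ker lfunE => /eqP.
Qed.

Lemma cartan_map_img i s : (p @: cs fullv i s = cs N i s)%VS.
Proof.
apply/vspaceP => G; apply/memv_imgP/idP => [[F /mem_cartan_sub FY ->]|].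
  apply/mem_cartan_sub => m; have := FY m;
    rewrite /slot lfunE /= ccoef_cartan_map.
  case: ifP => _; last by rewrite !memv0 => /eqP->; rewrite linear0.
  rewrite !memv_cap memvf /= => /fhom_fdeg->; rewrite andbT.
  by rewrite -[fhom D _]lfunE memv_img ?memvf.
move=> /mem_cartan_sub GN.
(* A linear preimage need not be homogeneous; projecting it to degree [s - i] repairs this, as
   [fhom D] preserves degrees. *)
pose F : cartan c := [ffun m =>
  fproj (s - i) (((linfun (fhom D))^-1)%VF (G m))].
have coefF m :
    ccoef m F = fproj (s - i) (((linfun (fhom D))^-1)%VF (ccoef m G)).
  rewrite /ccoef; case: insubP => [m' _ _|_] /=; first by rewrite ffunE.
  by rewrite !linear0.
exists F; last first.
  apply: cartanP => m; rewrite lfunE /= ccoef_cartan_map coefF fhom_fproj //.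
  have := GN m; rewrite /slot; case: ifP => _; last first.
    by rewrite memv0 => /eqP->; rewrite !linear0.
  rewrite memv_cap mem_fdeg => /andP[GNm /eqP Gd].
  by rewrite -[fhom D _]lfunE limg_lfunVK.
apply/mem_cartan_sub => m; have := GN m; rewrite /slot coefF; case: ifP => _.
  by move=> _; rewrite memv_cap memvf /= mem_fdeg fproj_id eqxx.
by rewrite !memv0 => /eqP->; rewrite !linear0.
Qed.

(** The long exact sequence of 0 -> X -> F -> N -> 0. The right side is the kernel of H_i(X) ->
    H_i(F): cycles of [X] that bound in the free module, modulo boundaries of [X]. *)
Lemma hdim_connecting i s : (i.+2 < b)%N ->
  hdim N i.+1 s = (\dim (cs X i s :&: boundaries fullv i s)
                   - \dim (boundaries X i s))%N.
Proof.
move=> ib; rewrite /hdim /boundaries -!cartan_map_img -!cartan_map_ker.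
apply: connecting_dim => [F||]; last exact: free_exact.
  by rewrite !lfunE /= cartan_map_d.
by apply: cartan_d_limg; apply: fullv_graded.
Qed.

Lemma hdim_shift i s : (i.+3 < b)%N -> hdim N i.+2 s = hdim X i.+1 s.
Proof.
move=> ib; rewrite hdim_connecting // /hdim free_exact 1?ltnW //.
congr (\dim _ - _)%N; rewrite capvA; congr (_ :&: _)%VS.
by apply/capv_idPl; apply: cartan_subS; apply: subvf.
Qed.

End ChainMap.
End Tor.

(** * Tor of the standard resolution through constant terms *)

Section TorDim.
Variables (K : fieldType) (n b : nat).
Local Notation fmod := (fmod K n).
Local Notation cartan a := {ffun 'X_{1..n < b} -> fmod a}.
Local Notation cs := (cartan_sub b).
Local Notation dl := (linfun (@cartan_d K n b _)).

Definition deg_mx (c : seq nat) j : 'M[K]_(size c) :=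
  diag_mx (\row_k (nth 0%N c k == j)%:R).

Lemma sub_deg_mx c j (v : 'rV_(size c)) :
  (v <= deg_mx c j)%MS = [forall l, (v 0 l != 0) ==> (nth 0%N c l == j)].
Proof.
apply/submxP/forallP => [[w ->] l|vj].
  by rewrite mul_mx_diag !mxE; case: (_ == j); rewrite ?mulr0 ?eqxx ?implybT.
exists v; apply/rowP => l; rewrite mul_mx_diag !mxE.
by have := vj l; case: (_ == j);
  rewrite /= ?mulr1 // implybF negbK mulr0 => /eqP.
Qed.

Lemma rank_deg_mx c j : \rank (deg_mx c j) = count (pred1 j) c.
Proof.
pose I := {k : 'I_(size c) | nth 0%N c k == j}.
have flin : linear (fun g : {ffun I -> K^o} =>
    \row_k (oapp g 0 (insub k : option I) : K)).
  move=> x g h; apply/rowP => k; rewrite !mxE; case: insub => [y|] /=.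
    by rewrite !ffunE.
  by rewrite mulr0 addr0.
pose f := linfun (HB.pack_for {linear {ffun I -> K^o} -> 'rV[K]_(size c)}
  (fun g : {ffun I -> K^o} => \row_k (oapp g 0 (insub k : option I) : K))
  (GRing.isSemilinear.Build _ _ _ _ _ (GRing.semilinear_linear flin))).
have fE g : f g = \row_k (oapp g 0 (insub k : option I) : K) by rewrite lfunE.
rewrite -(@dim_row_space _ _ _ _ (limg f)); last first.
  move=> v; rewrite sub_deg_mx; apply/memv_imgP/forallP => [[g _ ->] l|vj].
    rewrite fE mxE; case: insubP => [y -> _|]; rewrite ?implybT // => _ /=.
    by rewrite eqxx.
  exists [ffun y : I => v 0 (val y)]; rewrite ?memvf // fE.
  apply/rowP => k; rewrite mxE; case: insubP => [y _ <-|nkj] /=;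
    first by rewrite ffunE.
  by have := vj k; rewrite (negPf nkj) implybF negbK => /eqP.
rewrite limg_dim_eq.
  rewrite dimvf /dim /= muln1 card_sig -sum1_card big_mkcond /=.
  rewrite -sum1_count [RHS]big_mkcond (big_nth 0%N) big_mkord.
  by apply: eq_bigr.
apply/eqP; rewrite -subv0; apply/subvP => g;
  rewrite memv_cap memvf memv_ker fE /=.
move=> /eqP/rowP g0; rewrite memv0; apply/eqP/ffunP => y; rewrite ffunE.
by have := g0 (val y); rewrite !mxE valK.
Qed.

Definition gens a (M : {vspace fmod a}) : seq nat := unzip1 (std_gens M).

Lemma fdeg_out a j : (n + \max_(x <- a) x < j)%N -> fdeg K n a j = 0%VS.
Proof.
move=> jn; apply/eqP; rewrite -subv0; apply/subvP => f /mem_fdegP fj.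
rewrite memv0; apply/eqP/ffunP => l; apply/ffunP => S; rewrite !ffunE.
apply/eqP; apply: contraTT jn => /fj <-; rewrite -leqNgt leq_add //.
  by rewrite (leq_trans (max_card _)) ?card_ord.
by rewrite (leq_bigmax_seq (F := id)) ?mem_nth.
Qed.

Lemma count_gens a (M : {vspace fmod a}) j :
  count (pred1 j) (gens M) = \dim (M :&: fdeg K n a j).
Proof.
rewrite /gens /unzip1 /std_gens count_map count_flatten -map_comp sumnE big_map.
have countj j' :
   count (preim fst (pred1 j))
     [seq (j', v) | v <- vbasis (M :&: fdeg K n a j')] =
   if j' == j then \dim (M :&: fdeg K n a j') else 0%N.
  rewrite count_map; case: ifP => [jj|nj].
    transitivity (count predT (vbasis (M :&: fdeg K n a j'))).
      by apply: eq_count => v /=; rewrite jj.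
    by rewrite count_predT size_tuple.
  transitivity (count pred0 (vbasis (M :&: fdeg K n a j'))).
    by apply: eq_count => v /=; rewrite nj.
  by rewrite count_pred0.
under eq_bigr => j' _ do rewrite /= countj.
have [jin|jout] := boolP (j \in iota 0 (n + \max_(x <- a) x).+1).
  rewrite (bigD1_seq j) ?iota_uniq //= eqxx big1 ?addn0 // => j' /negPf nj.
  by rewrite nj.
rewrite fdeg_out ?capv0 ?dimv0;
  last by rewrite mem_iota add0n ltnS -ltnNge in jout.
by rewrite big_seq big1 // => j' jin; case: eqP => // ejj;
  rewrite -ejj jin in jout.
Qed.

(** The class of [f] in K (x) [fmod a], that is, modulo the maximal ideal m. *)
Definition const_row a (f : fmod a) : 'rV[K]_(size a) := \row_l f l set0.

Fact const_row_is_linear a : linear (@const_row a).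
Proof. by move=> x f g; apply/rowP => l; rewrite !mxE !ffunE. Qed.

HB.instance Definition _ a :=
  GRing.isSemilinear.Build K (fmod a) 'rV[K]_(size a) _ (@const_row a)
  (GRing.semilinear_linear (@const_row_is_linear a)).

Definition const_img a (M : {vspace fmod a}) j : {vspace 'rV[K]_(size a)} :=
  (linfun (@const_row a) @: (M :&: fdeg K n a j))%VS.

Lemma const_row_fproj a (f : fmod a) j :
  (const_row f <= deg_mx a j)%MS -> const_row (fproj j f) = const_row f.
Proof.
rewrite sub_deg_mx => /forallP fj; apply/rowP => l;
  rewrite !mxE !ffunE cards0 add0n.
by have := fj l; rewrite mxE; case: (_ == j); rewrite // implybF negbK => /eqP.
Qed.

Lemma const_row_deg a (f : fmod a) j :
  f \in fdeg K n a j -> (const_row f <= deg_mx a j)%MS.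
Proof.
move=> /mem_fdegP fj; rewrite sub_deg_mx; apply/forallP => l; apply/implyP.
by rewrite mxE => /fj; rewrite cards0 add0n => ->.
Qed.

Lemma const_img_fullv a j :
  \dim (const_img (fullv : {vspace fmod a}) j) = \rank (deg_mx a j).
Proof.
apply: dim_row_space => v; apply/memv_imgP/idP => [[f]|vj].
  by rewrite memv_cap lfunE /= => /andP[_ /const_row_deg fj] ->.
pose f : fmod a := [ffun l => v 0 l *: 1].
have fv : const_row f = v.
  by apply/rowP => l; rewrite !mxE !ffunE eqxx /GRing.scale /= mulr1.
exists (fproj j f); first by rewrite memv_cap memvf mem_fdeg fproj_id eqxx.
by rewrite lfunE /= const_row_fproj ?fv.
Qed.

Definition const_mx (c a : seq nat) (D : 'I_(size c) -> fmod a) :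
    'M[K]_(size c, size a) :=
  \matrix_(k, l) D k l set0.

Lemma const_row_fhom (c a : seq nat) (D : 'I_(size c) -> fmod a) g :
  const_row (fhom D g) = const_row g *m const_mx D.
Proof.
apply/rowP => l; rewrite !mxE ffunE sum_ffunE; apply: eq_bigr => k _.
rewrite ext_mulE (bigD1 set0) ?sub0set //= big1 ?addr0 => [|S].
  by rewrite !mxE set0D ext_inv0l mul1r.
by rewrite subset0 andbN.
Qed.

Section Homogeneous.
Variables (c a : seq nat) (D : 'I_(size c) -> fmod a).
Hypothesis Dhom : forall k, D k \in fdeg K n a (nth 0%N c k).
Local Notation M := (limg (linfun (fhom D))).

Lemma dim_const_img j : \dim (const_img M j) = \rank (deg_mx c j *m const_mx D).
Proof.
apply: dim_row_space => v; apply/memv_imgP/idP => [[f]|/submxP[w ->]].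
  rewrite memv_cap => /andP[/memv_imgP[g _ ->] fj] ->.
  rewrite !lfunE /= in fj *; move: fj;
    rewrite mem_fdeg -fhom_fproj // => /eqP<-.
  rewrite const_row_fhom submxMr // const_row_deg //.
  by rewrite mem_fdeg fproj_id eqxx.
pose g : fmod c := [ffun l => (w *m deg_mx c j) 0 l *: 1].
have gw : const_row g = w *m deg_mx c j.
  by apply/rowP => l; rewrite [in LHS]mxE !ffunE eqxx /GRing.scale /= mulr1.
exists (fhom D (fproj j g)).
  rewrite memv_cap -{1}[fhom D _]lfunE memv_img ?memvf //=.
  by rewrite fhom_fproj // mem_fdeg fproj_id eqxx.
by rewrite lfunE /= const_row_fhom const_row_fproj gw ?submxMl // mulmxA.
Qed.

Lemma dim_const_img_cap j : \dim (const_img M j) =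
  \rank (const_mx D :&: deg_mx a j)%MS.
Proof.
apply: dim_row_space => v; rewrite sub_capmx; apply/memv_imgP/andP => [[f]|[]].
  rewrite memv_cap => /andP[/memv_imgP[g _ ->] fj] ->.
  rewrite !lfunE /= in fj *; rewrite const_row_deg //.
  by rewrite const_row_fhom submxMl.
move=> /submxP[w ->] vj.
pose g : fmod c := [ffun l => w 0 l *: 1].
have gw : const_row g = w.
  by apply/rowP => l; rewrite [in LHS]mxE !ffunE eqxx /GRing.scale /= mulr1.
exists (fproj j (fhom D g)).
  rewrite memv_cap -fhom_fproj // -{1}[fhom D _]lfunE memv_img ?memvf //=.
  by rewrite fhom_fproj // mem_fdeg fproj_id eqxx.
by rewrite lfunE /= const_row_fproj const_row_fhom gw.
Qed.

Lemma rank_ker_const_mx j : \rank (kermx (const_mx D) :&: deg_mx c j)%MS =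
  (count (pred1 j) c - \dim (const_img M j))%N.
Proof.
rewrite dim_const_img -rank_deg_mx -(mxrank_mul_ker (deg_mx c j) (const_mx D)).
by rewrite addKn capmxC.
Qed.

End Homogeneous.

Definition cartan_const a : 'Hom(cartan a, 'rV[K]_(size a)) :=
  (linfun (@const_row a) \o linfun (@ccoef K n b a 0%MM))%VF.

Lemma cartan_constE a (F : cartan a) :
  cartan_const a F = const_row (ccoef 0%MM F).
Proof. by rewrite comp_lfunE !lfunE. Qed.

Lemma ccoef0_img a (N : {vspace fmod a}) j : (0 < b)%N ->
  (linfun (@ccoef K n b a 0%MM) @: cs N 0%N j = N :&: fdeg K n a j)%VS.
Proof.
move=> b0; apply/vspaceP => f; apply/memv_imgP/idP => [[F FN ->]|fN].
  rewrite lfunE /=; have /mem_cartan_sub/(_ 0%MM) := FN.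
  by rewrite /slot mdeg0 eqxx /= subn0.
pose g (m : 'X_{1..n}) : fmod a := if m == 0%MM then f else 0.
exists [ffun m : 'X_{1..n < b} => g m];
  last by rewrite lfunE /= ccoef_ffun mdeg0 b0 /g eqxx.
apply/mem_cartan_sub => m; rewrite ccoef_ffun /g; case: ifP => _;
  last exact: mem0v.
by case: eqP => [->|]; rewrite ?mem0v // /slot mdeg0 eqxx subn0.
Qed.

Lemma dim_cs0 a (N : {vspace fmod a}) j : (0 < b)%N ->
  \dim (cs N 0%N j) = \dim (N :&: fdeg K n a j).
Proof.
move=> b0; rewrite -ccoef0_img // limg_dim_eq //.
apply/eqP; rewrite -subv0; apply/subvP => F; rewrite memv_cap memv_ker lfunE /=.
move=> /andP[/mem_cartan_subP[_ Fs] /eqP F0]; rewrite memv0; apply/eqP.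
apply: cartanP => m; rewrite ccoef0; apply/ffunP => l; apply/ffunP => S.
rewrite !ffunE; apply/eqP; apply: contraT => nz; have [m0 _] := Fs m l S nz.
by move/eqP: m0 nz; rewrite mdeg_eq0 => /eqP->; rewrite F0 !ffunE eqxx.
Qed.

Lemma cartan_const_img a (N : {vspace fmod a}) j : (0 < b)%N ->
  (cartan_const a @: cs N 0%N j)%VS = const_img N j.
Proof. by move=> b0; rewrite limg_comp ccoef0_img. Qed.

(** At place 0 the boundaries of a free module F form mF, the kernel of taking constant terms. *)
Lemma boundaries0 a j : (1 < b)%N ->
  (cs fullv 0%N j :&: lker (cartan_const a) =
   boundaries b (fullv : {vspace fmod a}) 0%N j)%VS.
Proof.
move=> b1; apply/vspaceP => F; rewrite memv_cap memv_ker cartan_constE.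
apply/andP/memv_imgP => [[FY /eqP F0]|[G GY ->]]; last first.
  rewrite lfunE /= cartan_d_sub //; last exact: fullv_graded.
  split=> //; apply/eqP/rowP => l;
    rewrite !mxE ccoef_cartan_d sum_ffunE sum_ffunE.
  by rewrite big1 // => k _; rewrite fwedgeE inE.
have [G GY GP] := free_reduce b1 FY (cartan_d0 FY); exists G => //.
rewrite lfunE; apply/eqP; rewrite -subr_eq0; apply/eqP; apply: cartanP => m.
rewrite ccoef0; apply/ffunP => l; apply/ffunP => S; rewrite !ffunE.
apply/eqP; apply: contraT => nz; have [S0 m0] := GP m l S nz; move: nz.
rewrite S0 m0 ccoefB ccoef_cartan_d !ffunE sum_ffunE sum_ffunE big1 => [|k _].
  by have /rowP/(_ l) := F0; rewrite !mxE => ->; rewrite subrr eqxx.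
by rewrite fwedgeE inE.
Qed.

Lemma dim_const_img_cs a (N : {vspace fmod a}) j : (1 < b)%N ->
  (\dim (cs N 0%N j :&: boundaries b fullv 0%N j) + \dim (const_img N j))%N =
  \dim (cs N 0%N j).
Proof.
move=> b1; rewrite -(limg_ker_dim (cartan_const a) (cs N 0%N j))
  cartan_const_img 1?ltnW //.
rewrite -boundaries0 // capvA; congr (\dim (_ :&: _) + _)%N.
by apply/capv_idPl; apply: cartan_subS; apply: subvf.
Qed.

(** The counting hypothesis says that K (x) F and N have the same dimension in degree [j], as when
    the generators form a K-basis of N. The image of the syzygies in K (x) F is the kernel of the
    surjection onto N/mN, so its dimension is that of mN in degree [j]. *)
Lemma dim_boundaries0 (c a : seq nat) (D : 'I_(size c) -> fmod a) j :
  (1 < b)%N ->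
  (forall k, D k \in fdeg K n a (nth 0%N c k)) ->
  count (pred1 j) c = \dim (limg (linfun (fhom D)) :&: fdeg K n a j) ->
  \dim (const_img (lker (linfun (fhom D))) j) =
  \dim (boundaries b (limg (linfun (fhom D))) 0%N j).
Proof.
move=> b1 Dhom cntD; set N := limg _; set X := lker _; rewrite -/N in cntD.
have b0 := ltnW b1; pose p := linfun (@cartan_map K n b a c D).
have pB : (p @: boundaries b fullv 0%N j = boundaries b N 0%N j)%VS.
  rewrite /boundaries -(cartan_map_img b Dhom) -!limg_comp.
  by congr (_ @: _)%VS; apply/lfunP => F;
    rewrite !lfunE /= !lfunE /= cartan_map_d.
have BY : (boundaries b (fullv : {vspace fmod c}) 0%N j <= cs fullv 0%N j)%VS.
  by apply: cartan_d_limg; apply: fullv_graded.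
have Bp : (boundaries b fullv 0%N j :&: lker p =
  cs X 0%N j :&: boundaries b fullv 0%N j)%VS.
  rewrite -(cartan_map_ker b) -capvA [(lker _ :&: _)%VS]capvC capvA.
  by congr (_ :&: _)%VS; apply/esym/capv_idPr.
have := limg_ker_dim p (boundaries b fullv 0%N j); rewrite pB Bp.
have := limg_ker_dim p (cs fullv 0%N j).
rewrite (cartan_map_ker b) (cartan_map_img b Dhom) -/N -/X.
have := dim_const_img_cs X j b1;
  have := dim_const_img_cs (fullv : {vspace fmod c}) j b1.
rewrite const_img_fullv rank_deg_mx cntD (capv_idPr BY) -(dim_cs0 N j b0)
  => eY eX eN eB.
apply: (@addnI (\dim (cs X 0%N j :&: boundaries b fullv 0%N j))).
apply: etrans eX _; apply: etrans (esym eB).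
apply: (@addIn (\dim (cs N 0%N j))).
exact: etrans eN (esym eY).
Qed.

Definition syz a (M : {vspace fmod a}) : {vspace fmod (gens M)} :=
  lker (linfun (fhom (@std_map K n a M))).

Lemma syz_graded a (M : {vspace fmod a}) : graded_submod (syz M).
Proof. by apply: lker_graded => k; have [] := std_mapP k. Qed.

Lemma dim_const_img_syz a (M : {vspace fmod a}) j : (1 < b)%N ->
  graded_submod M ->
  \dim (const_img (syz M) j) = \dim (boundaries b M 0%N j).
Proof.
move=> b1 grM; rewrite /syz dim_boundaries0 ?limg_std_map //.
  by move=> k; have [] := std_mapP k.
exact: count_gens.
Qed.

Lemma dim_tor_boundaries a (M : {vspace fmod a}) j : graded_submod M ->
  \rank (const_mx (@std_map K n a M) :&: deg_mx a j)%MS = \dim (const_img M j).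
Proof.
move=> grM; rewrite -dim_const_img_cap ?limg_std_map // => k.
by have [] := std_mapP k.
Qed.

(** There are dim M_j generators of degree [j], and their constant terms span the image of M_j
    modulo m. The kernel thus has the dimension of the part of M_j inside m [fmod a]. *)
Lemma dim_tor_cycles a (M : {vspace fmod a}) j : (1 < b)%N -> graded_submod M ->
  \rank (kermx (const_mx (@std_map K n a M)) :&: deg_mx (gens M) j)%MS =
  \dim (cs M 0%N j :&: boundaries b fullv 0%N j).
Proof.
move=> b1 grM; rewrite rank_ker_const_mx; last by move=> k;
  have [] := std_mapP k.
rewrite limg_std_map // count_gens -dim_cs0 1?ltnW //.
by rewrite -(dim_const_img_cs M j b1) addnK.
Qed.

Lemma std_kernel_graded a (N : {vspace fmod a}) i :
  graded_submod N -> graded_submod (tagged (std_kernel N i)).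
Proof. by case: i => // i _; apply: syz_graded. Qed.

Lemma hdim_std_kernel a (N : {vspace fmod a}) i m s : graded_submod N ->
  (i + m.+2 < b)%N -> hdim b (tagged (std_kernel N i)) m.+1 s =
    hdim b N (i + m).+1 s.
Proof.
move=> grN; elim: i m => [//|i IH] m ib; rewrite addSnnS -IH; last by lia.
set M := tagged (std_kernel N i).
have Dhom k : @std_map K n _ M k \in fdeg K n _ (nth 0%N (gens M) k).
  by have [] := std_mapP k.
have mb : (m.+3 < b)%N by lia.
have := hdim_shift Dhom s mb; rewrite limg_std_map => [->//|].
exact: std_kernel_graded.
Qed.

Lemma tor_dim_std_resE a (N : {vspace fmod a}) i s :
  tor_dim (std_res N) i.+1 s =
  (\rank (kermx (const_mx (@std_map K n _ (tagged (std_kernel N i.+1)))) :&: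
          deg_mx (gens (tagged (std_kernel N i.+1))) s)%MS -
   \rank (const_mx (@std_map K n _ (syz (tagged (std_kernel N i.+1)))) :&:
          deg_mx (gens (tagged (std_kernel N i.+1))) s)%MS)%N.
Proof. by []. Qed.

(** Let M be the [i]-th syzygy module and X the kernel of its cover F -> M. Then Tor_(i+1) has the
    dimension of (X :&: mF)/mX, which is that of H_1(M) by [hdim_connecting] and of H_(i+1)(N) by
    [hdim_std_kernel]. Tor_0 is N/mN. *)
Lemma tor_dim_std_res a (N : {vspace fmod a}) i s : graded_submod N ->
  (i.+1 < b)%N ->
  tor_dim (std_res N) i s = hdim b N i s.
Proof.
move=> grN; case: i => [|i] ib.
  rewrite /tor_dim /tor_boundaries /=.
  rewrite [X in (X - _)%N](rank_deg_mx (gens N) s).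
  rewrite [X in (_ - X)%N](@dim_tor_boundaries _ (syz N) s (syz_graded N)).
  rewrite dim_const_img_syz // count_gens -dim_cs0 1?ltnW // /hdim.
  congr (\dim _ - _)%N; apply/esym/capv_idPl/subvP => F FN.
  by rewrite memv_ker lfunE /= (cartan_d0 FN).
rewrite tor_dim_std_resE dim_tor_cycles //; last first.
- exact: std_kernel_graded.
- by lia.
rewrite dim_tor_boundaries; last exact: syz_graded.
rewrite dim_const_img_syz; [|lia|exact: std_kernel_graded].
have grM := std_kernel_graded i grN.
rewrite -(addn0 i) -hdim_std_kernel //; last by lia.
rewrite addn0; set M := tagged (std_kernel N i) in grM *.
have Dhom k : @std_map K n _ M k \in fdeg K n _ (nth 0%N (gens M) k).
  by have [] := std_mapP k.
have b2 : (2 < b)%N by lia.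
by have := hdim_connecting Dhom s b2; rewrite limg_std_map // => ->.
Qed.

End TorDim.

(** * Linear quotients *)

Section LinearQuotients.
Variables (K : fieldType) (n b : nat).
Local Notation fmod := (fmod K n).
Local Notation a1 := [:: 0%N].
Local Notation cartan a := {ffun 'X_{1..n < b} -> fmod a}.
Local Notation cs := (cartan_sub b).
Local Notation dl := (linfun (@cartan_d K n b a1)).

Lemma cycles_dE i s (N : {vspace fmod a1}) F :
  (F \in (cs N i s :&: lker dl)%VS) = (F \in cs N i s) && (cartan_d F == 0).
Proof. by rewrite memv_cap memv_ker lfunE. Qed.

Lemma boundariesP i s (N : {vspace fmod a1}) F :
  reflect (exists2 G, G \in cs N i.+1 s & F = cartan_d G)
          (F \in boundaries b N i s).
Proof.
by apply: (iffP memv_imgP) => -[G GN ->]; exists G; rewrite ?lfunE.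
Qed.

Lemma boundaries_sub_cycles i s (N : {vspace fmod a1}) :
  graded_submod N -> (boundaries b N i s <= cs N i s :&: lker dl)%VS.
Proof.
move=> grN; apply/subvP => _ /boundariesP[G GN ->].
by rewrite cycles_dE cartan_d_sq eqxx cartan_d_sub.
Qed.

Definition supp_in (L : {set 'I_n}) (i : nat) : pred 'X_{1..n < b} :=
  fun m => (mdeg m == i) && [forall k, (k \notin L) ==> (m k == 0%N)].

(** Within the truncation: [N] has regularity at most [j]. *)
Definition exact_above (N : {vspace fmod a1}) j :=
  forall i s, (i.+1 < b)%N -> (i + j < s)%N ->
    (cs N i s :&: lker dl <= boundaries b N i s)%VS.

(** * Adding one generator *)

Section Step.
Variables (J U : pred {set 'I_n}) (u L : {set 'I_n}).
Hypotheses (upJ : forall S T : {set 'I_n}, S \subset T -> J S -> J T)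
           (upU : forall S T : {set 'I_n}, S \subset T -> U S -> U T)
           (uL : u \subset L)
           (JP : forall S : {set 'I_n}, J S -> S :&: L != u)
           (UE : forall S : {set 'I_n}, U S = J S || (S :&: L == u)).
Local Notation NJ := (monsub K a1 J).
Local Notation NU := (monsub K a1 U).
Hypothesis exJ : exact_above NJ #|u|.

Let uLu : u :&: L = u. Proof. exact/setIidPl. Qed.

Let nJu : ~~ J u. Proof. by apply/negP => /JP; rewrite uLu eqxx. Qed.

Let grU := monsub_graded K a1 upU.
Let grJ := monsub_graded K a1 upJ.

Let sJU i s : (cs NJ i s <= cs NU i s)%VS.
Proof.
apply: cartan_subS; apply/subvP => f /mem_monsub fJ; apply/mem_monsub => l S.
by move/fJ; rewrite UE => ->.
Qed.

Let degE i s (N : {vspace fmod a1}) (F : cartan a1) m l S :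
  F \in cs N i s -> ccoef m F l S != 0 ->
  mdeg m = i /\ (i + #|S| = s)%N.
Proof.
move=> /mem_cartan_subP[_ Fs] /Fs[-> <-]; split=> //.
by rewrite (ord1 l) addn0.
Qed.

Let csJ i s (F : cartan a1) : F \in cs NU i s ->
  (forall m l S, ~~ J S -> ccoef m F l S = 0) -> F \in cs NJ i s.
Proof.
move=> /mem_cartan_subP[FU Fs] F0; apply/mem_cartan_subP; split=> // m.
by apply/mem_monsub => l S; apply: contraR => /F0 ->.
Qed.

Let reduce i s (F : cartan a1) : (i.+1 < b)%N -> F \in cs NU i s ->
  cartan_d F \in cs NJ i.-1 s ->
  exists2 G, G \in cs NU i.+1 s & F - cartan_d G \in cs NU i s /\
    forall m l S, ~~ J S -> ccoef m (F - cartan_d G) l S != 0 ->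
      [/\ S = u, s = (i + #|u|)%N, mdeg m = i
        & forall k, k \notin L -> m k = 0%N].
Proof.
move=> ib FU /mem_cartan_subP[dFJ _].
have [G GU GP] := homotopy_reduce upJ upU JP UE ib FU dFJ.
have FG : F - cartan_d G \in cs NU i s by rewrite memvB // cartan_d_sub.
exists G => //; split=> // m l S nJ nz; have [Su mL] := GP m l S nJ nz.
by have [-> <-] := degE FG nz; rewrite Su.
Qed.

Lemma exact_above_step : exact_above NU #|u|.
Proof.
move=> i s ib lt_s; apply/subvP => F; rewrite cycles_dE => /andP[FU /eqP dF0].
have [|G GU [FGU FG]] := reduce ib FU; first by rewrite dF0 mem0v.
have : F - cartan_d G \in (cs NJ i s :&: lker dl)%VS.
  rewrite cycles_dE linearB /= cartan_d_sq dF0 subr0 eqxx andbT.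
  apply: csJ => // m l S nJ; apply/eqP; apply: contraTT lt_s => nz.
  by have [_ -> _ _] := FG m l S nJ nz; rewrite ltnn.
move=> /(subvP (exJ ib lt_s))/boundariesP[H HJ eH].
apply/boundariesP; exists (G + H).
  by rewrite memvD // (subvP (sJU _ _)).
by rewrite linearD /= -eH addrC subrK.
Qed.

Let I i := {m : 'X_{1..n < b} | supp_in L i m}.

(** Coordinates on the classes of the e_u x^(m), the only terms outside [J] that [reduce] may
    leave. *)
Let phi_fun i (F : cartan a1) : {ffun I i -> K^o} :=
  [ffun y : I i => ccoef (val y : 'X_{1..n < b}) F ord0 u].

Let phi_linear i : linear (@phi_fun i).
Proof. by move=> x F G; apply/ffunP => y; rewrite !ffunE linearP !ffunE. Qed.

Let phi i : 'Hom(cartan a1, {ffun I i -> K^o}) :=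
  linfun (HB.pack_for {linear cartan a1 -> {ffun I i -> K^o}} (@phi_fun i)
    (GRing.isSemilinear.Build _ _ _ _ _
      (GRing.semilinear_linear (@phi_linear i)))).

Let phiE i F y : phi i F y = ccoef (val y) F ord0 u.
Proof. by rewrite lfunE /= ffunE. Qed.

(** Removing any element of [u] leads out of [U], so no e_k e_T with [U T] is ± e_u. *)
Let d_coef_u i s (G : cartan a1) m l : G \in cs NU i s ->
  ccoef m (cartan_d G) l u = 0.
Proof.
move=> /mem_cartan_subP[GU _]; rewrite ccoef_cartan_d sum_ffunE sum_ffunE big1
  // => k _.
rewrite fwedgeE; case: ifP => // ku; rewrite (@monsub_coord0 _ _ _ U) ?mulr0 //.
rewrite UE negb_or; apply/andP; split.
  by apply: contra nJu; apply: upJ; apply: subsetDl.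
by apply/eqP => /setP/(_ k); rewrite !inE eqxx ku.
Qed.

Let cycles_ker_phi i s : (i.+1 < b)%N ->
  ((cs NU i s :&: lker dl) :&: lker (phi i) =
   boundaries b NU i s + (cs NJ i s :&: lker dl))%VS.
Proof.
move=> ib; apply/vspaceP => F; apply/idP/idP.
  rewrite memv_cap cycles_dE memv_ker => /andP[/andP[FU /eqP dF0] /eqP phiF].
  have [|G GU [FGU FG]] := reduce ib FU; first by rewrite dF0 mem0v.
  rewrite -[F](subrK (cartan_d G)) addrC memv_add //.
    by apply/boundariesP; exists G.
  rewrite cycles_dE linearB /= cartan_d_sq dF0 subr0 eqxx andbT.
  apply: csJ => // m l S nJ; apply/eqP; apply: contraT => nz.
  have [Su _ mi mL] := FG m l S nJ nz; case/negP: (nz).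
  have mb : (mdeg m < b)%N by rewrite mi ltnW.
  have mI : supp_in L i (BMultinom mb).
    by rewrite /supp_in mi eqxx; apply/forallP => k; apply/implyP => /mL/eqP.
  have := phiE F (exist (fun m => supp_in L i m) _ mI);
    rewrite phiF ffunE => /esym/= F0.
  move: (d_coef_u m l GU); rewrite Su ccoefB (ord1 l) in F0 * => dG0.
  by rewrite !ffunE F0 dG0 subrr.
move: F; apply/subvP; rewrite subv_add; apply/andP; split; apply/subvP => G.
  move=> /[dup] /(subvP (boundaries_sub_cycles i s grU))
    Gc /boundariesP[H HU eG].
  rewrite memv_cap Gc memv_ker; apply/eqP/ffunP => y.
  by rewrite phiE eG (d_coef_u _ _ HU) ffunE.
rewrite cycles_dE => /andP[GJ dG0].
rewrite memv_cap cycles_dE (subvP (sJU _ _) _ GJ) dG0 memv_ker.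
apply/eqP/ffunP => y; rewrite phiE ffunE; apply/eqP; apply: contraR nJu.
by have /mem_cartan_subP[/(_ (val y))/mem_monsub GJ' _] := GJ; apply: GJ'.
Qed.

(** No homology of [NJ] dies in [NU]. A chain with boundary in [NJ] can be reduced into [NJ] unless
    [s = i.+1 + #|u|], and in that degree [NJ] is itself exact at place [i]. *)
Let boundaries_cap i s : (i.+2 < b)%N ->
  (boundaries b NU i s :&: (cs NJ i s :&: lker dl) = boundaries b NJ i s)%VS.
Proof.
move=> ib; apply/vspaceP => F; rewrite memv_cap; apply/andP/idP; last first.
  move=> FB; rewrite (subvP (boundaries_sub_cycles i s grJ)) //; split=> //.
  by move: F FB; apply/subvP/limgS/sJU.
case=> /boundariesP[H HU ->]; have [sE Hc|ns] := eqVneq s (i.+1 + #|u|)%N.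
  have lt_s : (i + #|u| < s)%N by rewrite sE.
  exact: (subvP (exJ (ltnW ib) lt_s)) Hc.
rewrite cycles_dE => /andP[dHJ _].
have [G GU [HGU HG]] := reduce ib HU dHJ.
apply/boundariesP; exists (H - cartan_d G);
  last by rewrite linearB /= cartan_d_sq subr0.
apply: csJ => // m l S nJ; apply/eqP; apply: contraNT ns => nz.
by have [_ ->] := HG m l S nJ nz.
Qed.

Let dim_phi i s : (i.+1 < b)%N ->
  \dim (phi i @: (cs NU i s :&: lker dl)) =
  (if s == i + #|u| then #|supp_in L i| else 0)%N.
Proof.
move=> ib; case: eqVneq => [sE|ns]; last first.
  apply/eqP; rewrite dimv_eq0 -subv0; apply/subvP => _ /memv_imgP[F FZ ->].
  rewrite memv0; apply/eqP/ffunP => y; rewrite phiE ffunE; apply/eqP.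
  apply: contraT => nz; move: FZ;
    rewrite memv_cap => /andP[/degE/(_ nz)[_ sE] _].
  by rewrite sE eqxx in ns.
have -> : (phi i @: (cs NU i s :&: lker dl) = fullv)%VS.
  apply/vspaceP => g; rewrite memvf; apply/memv_imgP.
  pose h (m : 'X_{1..n}) : fmod a1 := [ffun l => [ffun S : {set 'I_n} =>
    if S == u then oapp (fun m' => oapp g 0 (insub m' : option (I i))) 0
       (insub m : option 'X_{1..n < b}) else 0] : ext K n].
  pose x : cartan a1 := [ffun m : 'X_{1..n < b} => h m].
  have xE (m : 'X_{1..n < b}) l S : ccoef m x l S =
      if S == u then oapp g 0 (insub m : option (I i)) else 0.
    by rewrite ccoef_ffun bmdeg /h !ffunE valK.
  have xP m l S : ccoef m x l S != 0 ->
    [/\ S = u, mdeg m = i & forall k, k \notin L -> m k = 0%N].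
    have [mb|bm] := ltnP (mdeg m) b; last by rewrite ccoef_out // !ffunE eqxx.
    rewrite (xE (BMultinom mb)); case: (eqVneq S u) => [->|_];
      last by rewrite eqxx.
    case: insubP => [y + _ _|_]; last by rewrite eqxx.
    move=> /andP[/eqP mi /forallP mL]; split=> // k kL.
    by have /implyP/(_ kL)/eqP := mL k.
  have Uu : U u by rewrite UE uLu eqxx orbT.
  have xU : x \in cs NU i s.
    apply/mem_cartan_subP; split=> [m|m l S];
      first by apply/mem_monsub => l S /xP[->].
    by move=> /xP[-> -> _]; split=> //; rewrite (ord1 l) addn0 sE.
  have phix : phi i x = g.
    by apply/ffunP => y; rewrite phiE xE eqxx valK.
  (* [x] need not be a cycle, but its boundary lies in [NJ], since e_k e_u does for k in [L] outside
     [u]. Exactness of [NJ] at place [i.-1] gives [y], and [x - y] is a cycle with the same image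
     under [phi]. *)
  have [y yJ dy] : exists2 y, y \in cs NJ i s & cartan_d y = cartan_d x.
    have [i0|i_gt0] := posnP i.
      by exists 0; rewrite ?mem0v // linear0; move: xU;
        rewrite i0 => /cartan_d0->.
    have ip : i.-1.+1 = i by rewrite prednK.
    have dxU : cartan_d x \in cs NU i.-1 s by apply: cartan_d_sub; rewrite ?ip.
    have dxJ : cartan_d x \in (cs NJ i.-1 s :&: lker dl)%VS.
      rewrite cycles_dE cartan_d_sq eqxx andbT; apply: csJ => // m l S nJ.
      have /mem_cartan_subP[/(_ m)/mem_monsub dxU' _] := dxU.
      apply/eqP; apply: contraNT nJ => nz; have := dxU' l S nz.
      rewrite UE => /orP[//|/eqP SL]; move: nz.
      rewrite ccoef_cartan_d sum_ffunE sum_ffunE big1 ?eqxx // => k _.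
      rewrite fwedgeE; case: ifP => // kS; apply/eqP.
      rewrite mulf_eq0; apply/orP; right; apply: contraT => /xP[Su _ mL].
      have kL : k \in L.
        by apply: contraT => /mL; rewrite mnmDE mnm1E eqxx addn1.
      have : k \in u by rewrite -SL inE kS.
      by rewrite -Su !inE eqxx.
    have lt_s : (i.-1 + #|u| < s)%N by rewrite sE ltn_add2r ltn_predL.
    have ib' : (i.-1.+1 < b)%N by rewrite ip ltnW.
    by have /boundariesP[y] := subvP (exJ ib' lt_s) _ dxJ; rewrite ip; exists y.
  exists (x - y).
    by rewrite cycles_dE memvB // ?(subvP (sJU _ _))
      //= linearB /= dy subrr eqxx.
  rewrite linearB /= phix; apply/ffunP => z; rewrite !ffunE phiE.
  rewrite (_ : ccoef _ _ _ _ = 0) ?subr0 //; apply/eqP; apply: contraR nJu.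
  by have /mem_cartan_subP[/(_ (val z))/mem_monsub yJ' _] := yJ; apply: yJ'.
by rewrite dimvf /dim /= muln1 card_sig.
Qed.

(** Rank-nullity for [phi] on cycles: its kernel modulo boundaries is the homology of [NJ], its
    image counts the new classes. *)
Lemma hdim_step i s : (i.+2 < b)%N ->
  hdim b NU i s =
  (hdim b NJ i s + if s == i + #|u| then #|supp_in L i| else 0)%N.
Proof.
move=> ib; have ib1 := ltnW ib; rewrite /hdim -(dim_phi s ib1).
have := limg_ker_dim (phi i) (cs NU i s :&: lker dl).
rewrite cycles_ker_phi //.
have := dimv_sum_cap (boundaries b NU i s) (cs NJ i s :&: lker dl).
rewrite boundaries_cap //.
have := dimvS (boundaries_sub_cycles i s grJ).
have arith (x y z p q r : nat) : (p <= q -> x + p = y + q -> x + z = r ->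
    r - y = q - p + z)%N by lia.
exact: arith.
Qed.

End Step.

Definition upset (us : seq {set 'I_n}) : pred {set 'I_n} :=
  fun S => has (fun u : {set 'I_n} => u \subset S) us.

Lemma upset_up us (S T : {set 'I_n}) : S \subset T -> upset us S -> upset us T.
Proof.
move=> sST /hasP[u u_in uS]; apply/hasP; exists u => //;
  exact: subset_trans sST.
Qed.

(* For S containing the generator u, e_S lies in the ideal of the earlier     *)
(* generators iff S contains a variable of L u outside u; hence the colon     *)
(* ideal of u by its predecessors is generated by the variables in L u, which *)
(* include those of u as e_i^2 = 0.                                           *)
Definition linear_quotients (L : {set 'I_n} -> {set 'I_n})
    (us : seq {set 'I_n}) :=
  forall us1 (u : {set 'I_n}) us2, us = us1 ++ u :: us2 ->
    [/\ u \subset L u, {in us1, forall v : {set 'I_n}, (#|v| <= #|u|)%N}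
      & forall S : {set 'I_n}, u \subset S -> upset us1 S = (S :&: L u != u)].

Lemma cs0 i s : cs (0 : {vspace fmod a1}) i s = 0%VS.
Proof.
apply/eqP; rewrite -subv0; apply/subvP => F /mem_cartan_subP[F0 _].
rewrite memv0; apply/eqP; apply: cartanP => m; rewrite ccoef0.
by have := F0 m; rewrite memv0 => /eqP.
Qed.

Lemma monsub_nil : monsub K a1 (upset [::]) = 0%VS.
Proof.
apply/eqP; rewrite -subv0; apply/subvP => f /mem_monsub f0; rewrite memv0.
apply/eqP/ffunP => l; apply/ffunP => S; rewrite !ffunE; apply/eqP.
by apply: contraT => /f0.
Qed.

(** Both parts go through one induction: adding [u] needs exactness of the earlier ideal above
    [#|u|], available because earlier generators are not larger. *)
Lemma hdim_linear_quotients L us : linear_quotients L us ->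
  (forall i s, (i.+2 < b)%N ->
     hdim b (monsub K a1 (upset us)) i s =
     \sum_(u <- us | s == i + #|u|) #|supp_in (L u) i|)%N /\
  (forall j, {in us, forall v : {set 'I_n}, (#|v| <= j)%N} ->
     exact_above (monsub K a1 (upset us)) j).
Proof.
elim/last_ind: us => [_|us u IH lq].
  rewrite monsub_nil; split=> [i s _|j _ i s _ _].
    by rewrite /hdim cs0 cap0v dimv0 sub0n big_nil.
  by rewrite cs0 cap0v sub0v.
have [uL le_u JE] := lq us u [::] (esym (cats1 _ _)).
have [|hJ eJ] := IH; first by move=> us1 v us2 e;
  apply: (lq us1 v (rcons us2 u));
  rewrite e rcons_cat.
have JP (S : {set 'I_n}) : upset us S -> S :&: L u != u.
  move=> JS; apply/eqP => SL; move: JS; rewrite JE ?SL ?eqxx //.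
  by rewrite -SL subsetIl.
have UE (S : {set 'I_n}) : upset (rcons us u) S =
  upset us S || (S :&: L u == u).
  rewrite /upset has_rcons orbC -/(upset us S).
  have [uS|uS] := boolP (u \subset S); first by rewrite JE // orbT orNb.
  by case: eqP => [SL|_]; rewrite ?orbF //; rewrite -SL subsetIl in uS.
have exJ := eJ _ le_u; split=> [i s ib|j le_j i s ib lt_s].
  rewrite (hdim_step (@upset_up us) (@upset_up (rcons us u)) uL JP UE exJ) //.
  by rewrite hJ // -cats1 big_cat big_cons big_nil /=; case: ifP => _;
    rewrite ?addn0.
have exU := exact_above_step (@upset_up us) (@upset_up (rcons us u)) JP UE exJ.
apply: exU => //; by rewrite (leq_ltn_trans _ lt_s)
  // leq_add2l le_j // mem_rcons inE eqxx.
Qed.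

Lemma ideal_fmodE (A : {set {set 'I_n}}) us : A =i us ->
  ideal_fmod (ideal_gen K A) = monsub K a1 (upset us).
Proof.
move=> Aus; apply/vspaceP => f;
  rewrite /ideal_fmod -memv_preim lfunE /= /fcoord.
rewrite mem_ideal_gen.
have AE (S : {set 'I_n}) : [exists T, (T \in A) && (T \subset S)] = upset us S.
  apply/existsP/hasP => [[T /andP[TA TS]]|[T Tus TS]]; exists T; rewrite ?TS //.
    by rewrite -Aus.
  by rewrite Aus Tus.
apply/forallP/idP => [fA|/mem_monsub fA S].
  by apply/mem_monsub => l S; rewrite (ord1 l) -AE; apply/implyP.
by rewrite AE; apply/implyP => /fA.
Qed.

End LinearQuotients.

(** * Counting divided power monomials *)

Section CountMonomials.
Variables n b : nat.
Implicit Types (L : {set 'I_n}) (m : 'X_{1..n < b}).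

Lemma supp_inP L i (m : 'X_{1..n < b}) :
  reflect (mdeg m = i /\ forall k, k \notin L -> m k = 0%N) (supp_in L i m).
Proof.
apply: (iffP andP) => [[/eqP mi /forallP mL]|[/eqP mi mL]]; split=> //.
  by move=> k kL; have /implyP/(_ kL)/eqP := mL k.
by apply/forallP => k; apply/implyP => /mL/eqP.
Qed.

Lemma card_supp_in0 L : (0 < b)%N -> #|@supp_in n b L 0| = 1%N.
Proof.
move=> b0; have b00 : (mdeg (0%MM : 'X_{1..n}) < b)%N by rewrite mdeg0.
rewrite -(card1 (BMultinom b00)); apply: eq_card => m; rewrite !inE.
apply/supp_inP/eqP => [[/eqP]|->]; last by rewrite /= mdeg0; split=> // k _;
  rewrite mnm0E.
by rewrite mdeg_eq0 => /eqP m0 _; apply: val_inj.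
Qed.

Lemma card_supp_inS L i k : (i.+1 < b)%N -> k \in L ->
  #|@supp_in n b L i.+1| = (#|@supp_in n b L i| +
    #|@supp_in n b (L :\ k) i.+1|)%N.
Proof.
move=> ib kL; rewrite -(cardID [pred m : 'X_{1..n < b} | 0 < m k]%N);
  congr (_ + _)%N; last first.
  apply: eq_card => m; rewrite !inE /= lt0n negbK.
  apply/andP/supp_inP => [[/eqP mk /supp_inP[mi mL]]|[mi mL]].
    split=> // l; rewrite !inE negb_and negbK => /orP[/eqP->//|]; exact: mL.
  split; first by rewrite mL // !inE eqxx.
  by apply/supp_inP; split=> // l lL; rewrite mL // !inE (negPf lL) andbF.
(* Multiplication by x_k; the default is never reached in degree [i], as [i.+1 < b]. *)
pose f m : 'X_{1..n < b} := odflt m (insub (m + U_(k))%MM).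
have fE m : mdeg m = i -> f m = (m + U_(k))%MM :> 'X_{1..n}.
  by move=> mi; rewrite /f insubT /= ?mdegD ?mdeg1 ?mi ?addn1.
rewrite -(@card_in_image _ _ f (supp_in L i)); last first.
  move=> m m' mA mA' /(congr1 val) /=;
    have /supp_inP[mi _] : supp_in L i m := mA.
  have /supp_inP[mi' _] : supp_in L i m' := mA'.
  by rewrite !fE // => /addIm /val_inj.
apply: eq_card => m; rewrite !inE /=;
  apply/andP/imageP => [[/supp_inP[mi mL] mk]|].
  have Um : (U_(k) <= m)%MM by rewrite lep1mP -lt0n.
  have mi' : mdeg (m - U_(k))%MM = i.
    by apply: succn_inj; rewrite -mi -{2}(submK Um) mdegD mdeg1 addn1.
  have mb : (mdeg (m - U_(k))%MM < b)%N by rewrite mi' ltnW.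
  exists (BMultinom mb); last by apply: val_inj; rewrite /= fE //= submK.
  by apply/(supp_inP L i (BMultinom mb)); split=> //= l lL;
    rewrite mnmBE mL ?sub0n.
case=> m' mA ->; have /supp_inP[mi mL] : supp_in L i m' := mA.
 rewrite fE // mnmDE mnm1E eqxx addn1; split=> //.
apply/supp_inP; rewrite fE // mdegD mdeg1 mi addn1; split=> // l lL.
by rewrite mnmDE mnm1E mL //; case: eqP => // kl; rewrite kl (negPf lL) in kL.
Qed.

Lemma card_supp_in L i : (i < b)%N -> #|@supp_in n b L i| = 'C(#|L| + i - 1, i).
Proof.
move cL: #|L| => l; elim: l i L cL => [|l IHl].
  move=> [|i] L cL ib; first by rewrite card_supp_in0.
  rewrite bin_small ?add0n ?subn1 //; apply: eq_card0 => m; rewrite inE.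
  apply/negP => /supp_inP[mi mL]; move: mi; rewrite mdegE big1 // => k _.
  by rewrite mL // (cards0_eq cL) inE.
elim=> [|i IHi] L cL ib; first by rewrite card_supp_in0 ?bin0.
have /set0Pn[k kL] : L != set0 by rewrite -card_gt0 cL.
rewrite (card_supp_inS ib kL) IHi // 1?ltnW // IHl //.
  by rewrite !addSn addnS !subn1 /= binS addnC.
by move: cL; rewrite (cardsD1 k) kL => -[].
Qed.

End CountMonomials.

(** * Vector-spread strongly stable ideals *)

Section Spaced.
Local Open Scope nat_scope.
Variables (n : nat) (tau : nat -> nat).
Implicit Types (S T u v : {set 'I_n}) (x y k : 'I_n) (z : nat).

(* nbelow S x is the 0-based position of x in S. If #|S| <= #|T|, then        *)
(* nbelow S <= nbelow T pointwise iff the i-th element of S is at least the   *)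
(* i-th element of T, for all i < #|S|.                                       *)
Definition nbelow S z : nat := \sum_(y in S) (y < z).

Lemma nbelow_card S z : n <= z -> nbelow S z = #|S|.
Proof.
move=> nz; rewrite /nbelow -sum1_card; apply: eq_bigr => y _.
by rewrite (leq_trans (ltn_ord y) nz).
Qed.

Lemma leq_nbelow S z z' : z <= z' -> nbelow S z <= nbelow S z'.
Proof.
move=> zz; apply: leq_sum => y _; case: (ltnP y z) => // yz.
by rewrite (leq_trans yz zz).
Qed.

Lemma nbelow_leq_card S z : nbelow S z <= #|S|.
Proof.
by rewrite -(nbelow_card S (leq_maxr z n)) leq_nbelow ?leq_maxl.
Qed.

Lemma nbelow0 S : nbelow S 0 = 0.
Proof. by rewrite /nbelow big1. Qed.

Lemma nbelowS S x : nbelow S x.+1 = nbelow S x + (x \in S).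
Proof.
rewrite /nbelow; have -> : (x \in S : nat) = \sum_(y in S) (y == x).
  have [xS|xS] := boolP (x \in S); last first.
    by rewrite big1 // => y yS; case: eqP => // yx; rewrite -yx yS in xS.
  by rewrite (bigD1 x) //= eqxx big1 // => y /andP[_ /negPf->].
rewrite -big_split; apply: eq_bigr => y _ /=.
by rewrite ltnS leq_eqVlt -val_eqE /=; case: ltngtP.
Qed.

Lemma nbelow_lt S y z : y \in S -> y < z -> nbelow S y < nbelow S z.
Proof.
by move=> yS yz; rewrite (leq_trans _ (leq_nbelow S yz)) // nbelowS yS addn1.
Qed.

Lemma nbelow_ex S g z : g < nbelow S z ->
  exists y, [/\ y \in S, y < z & nbelow S y = g].
Proof.
elim: z => [|z IH]; first by rewrite nbelow0.
have [zn|nz] := ltnP z n; last first.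
  move=> gz; have [|y [yS yz <-]] := IH;
    first by rewrite nbelow_card // -(nbelow_card S (leqW nz)).
  by exists y; rewrite ltnS ltnW.
pose x := Ordinal zn; rewrite (nbelowS S x);
  have [gz _|zg] := ltnP g (nbelow S z).
  by have [y [yS yz <-]] := IH gz; exists y; rewrite ltnS ltnW.
case xS: (x \in S); last by rewrite addn0 ltnNge zg.
rewrite addn1 ltnS => gz; exists x; split=> //.
by apply/eqP; rewrite eqn_leq zg gz.
Qed.

Lemma next_elt S x : x \notin S -> nbelow S x < #|S| ->
  exists y, [/\ y \in S, x < y & forall w : 'I_n, w \in S -> x < w -> y <= w].
Proof.
move=> xS; rewrite -(nbelow_card S (leqnn n)) => /nbelow_ex[y [yS _ yx]].
exists y; split=> // [|z zS xz].
  rewrite ltn_neqAle; apply/andP; split.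
    by apply: contra xS => /eqP/val_inj->.
  by rewrite leqNgt; apply/negP => /(nbelow_lt yS); rewrite yx ltnn.
rewrite leqNgt; apply/negP => /(nbelow_lt zS); rewrite yx ltnNge.
by rewrite leq_nbelow // ltnW.
Qed.

Lemma nbelow_exchange S x y z : x \notin S -> y \in S -> x < y ->
  nbelow (x |: S :\ y) z = nbelow S z + ((x < z) && (z <= y)).
Proof.
move=> xS yS xy; rewrite /nbelow big_setU1 /= ?inE ?(negPf xS) ?andbF //.
rewrite [in RHS](big_setD1 y) //= addnAC; congr (_ + _); lia.
Qed.

Lemma card_exchange S x y : x \notin S -> y \in S -> #|x |: S :\ y| = #|S|.
Proof.
by move=> xS yS; rewrite cardsU1 inE (negPf xS) andbF [in RHS](cardsD1 y) yS.
Qed.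

(** Equal to the sum of n - y over y in [S], so it grows as elements move down. *)
Definition weight S := \sum_(z < n.+1) nbelow S z.

Lemma weight_exchange S x y : x \notin S -> y \in S -> x < y ->
  weight S < weight (x |: S :\ y).
Proof.
move=> xS yS xy; have xn : x.+1 < n.+1 by rewrite ltnS.
rewrite /weight (bigD1 (Ordinal xn)) //= [X in _ < X](bigD1 (Ordinal xn)) //=.
rewrite -addSn leq_add //; first by rewrite nbelow_exchange // ltnS leqnn xy
  addn1.
by apply: leq_sum => z _; rewrite nbelow_exchange // leq_addr.
Qed.

Lemma nbelow_inj S T : (forall z, z <= n -> nbelow S z = nbelow T z) -> S = T.
Proof.
move=> eST; apply/setP => x; have := nbelowS S x; have := nbelowS T x.
rewrite !eST // 1?ltnW // => -> /addnI.
by do 2 case: (_ \in _).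
Qed.

Lemma weight_eq S T :
  (forall z, nbelow S z <= nbelow T z) -> weight T <= weight S -> S = T.
Proof.
move=> leST; rewrite -subn_eq0 /weight -sumnB; last by move=> z _; apply: leST.
rewrite sum_nat_eq0 => /forallP e; apply: nbelow_inj => z; rewrite -ltnS => zn.
by have := e (Ordinal zn); rewrite /= subn_eq0 => le; apply/eqP;
  rewrite eqn_leq leST.
Qed.

Lemma weight_lt S : weight S < (n.+1 * n.+1).+1.
Proof.
rewrite ltnS -{1}(card_ord n.+1) -sum_nat_const; apply: leq_sum => z _.
by rewrite (leq_trans (nbelow_leq_card S z)) // (leq_trans (max_card _))
  ?card_ord.
Qed.

Definition spaced S :=
  forall x y, x \in S -> y \in S -> x < y -> x + tau (nbelow S x) <= y.

(** As [S] has no element between them, x takes over the position of y: the gap after it only grows,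
    and the gaps before it are the last hypothesis. *)
Lemma spaced_exchange S x y : spaced S -> x \notin S -> y \in S -> x < y ->
  (forall w : 'I_n, w \in S -> x < w -> y <= w) ->
  (forall w : 'I_n, w \in S -> w < x -> w + tau (nbelow S w) <= x) ->
  spaced (x |: S :\ y).
Proof.
move=> spS xS yS xy gap low k l; rewrite !inE.
case/predU1P=> [->|/andP[ky kS]]; case/predU1P=> [->|/andP[ly lS]].
- by rewrite ltnn.
- move=> xl; rewrite nbelow_exchange // ltnn addn0.
  have yl : y < l by rewrite ltn_neqAle gap // andbT eq_sym.
  have -> : nbelow S x = nbelow S y.
    apply: eq_bigr => z zS; have := gap z zS;
      case: (ltngtP x z) => [xz /(_ isT)|zx _|xz].
    - by case: ltngtP.
    - by rewrite (ltn_trans zx xy).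
    by move: xS; rewrite (val_inj xz) zS.
  by have := spS y l yS lS yl; lia.
- move=> kx; rewrite nbelow_exchange //.
  by rewrite ltnNge (ltnW kx) /= addn0 low.
move=> kl; rewrite nbelow_exchange //; suff -> : (x < k) && (k <= y) = false.
  by rewrite addn0 spS.
apply/negP => /andP[xk ky']; have := gap k kS xk => yk; case/negP: ky.
by apply/eqP/val_inj/eqP; rewrite eqn_leq ky' yk.
Qed.

Definition colon_vars u : {set 'I_n} :=
  [set k : 'I_n | [exists y in u, k <= y] &&
           [forall x in u, (x < k) ==> (x + tau (nbelow u x) <= k)]].

Lemma colon_varsP u k : reflect ((exists2 y, y \in u & k <= y) /\
    forall x, x \in u -> x < k -> x + tau (nbelow u x) <= k)
  (k \in colon_vars u).
Proof.
rewrite inE; apply: (iffP andP) => -[].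
  move=> /existsP[y /andP[yu ky]] /forallP uk; split; first by exists y.
  by move=> x xu xk; have /implyP/(_ xu)/implyP/(_ xk) := uk x.
case=> y yu ky uk; split; first by apply/existsP; exists y; rewrite yu.
by apply/forallP => x; apply/implyP => xu; apply/implyP => /(uk x xu).
Qed.

Lemma sub_colon_vars u : spaced u -> u \subset colon_vars u.
Proof.
by move=> spu; apply/subsetP => k ku; apply/colon_varsP; split=> [|x xu];
  [exists k | apply: spu].
Qed.

(** Position by position, [v] cannot get below [u]: the first element x of [v] to do so would be
    outside [u] yet in [colon_vars u], because the spacing of [v] passes to the smaller elements of
    [u]. *)
Lemma nbelow_colon u v (T : {set 'I_n}) : spaced v -> v \subset T ->
  T :&: colon_vars u \subset u -> #|v| <= #|u| ->
  forall z, nbelow v z <= nbelow u z.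
Proof.
move=> spv /subsetP vT /subsetP TL le_vu; elim/ltn_ind=> -[|z] IHs;
  first by rewrite !nbelow0.
have IH := IHs z (ltnSn z).
have [zn|nz] := ltnP z n; last by rewrite !nbelow_card // leqW.
pose x := Ordinal zn; rewrite !(nbelowS _ x).
have [xu|xu] := boolP (x \in u); first by rewrite leq_add ?leq_b1.
have [xv|xv] := boolP (x \in v); last by rewrite leq_add.
have [|] := ltnP (nbelow v z) (nbelow u z); first by rewrite addn1 addn0.
move=> uv; have {uv} eq_uv : nbelow v z = nbelow u z by apply/eqP;
  rewrite eqn_leq IH.
have lt_u : nbelow u z < #|u|.
  by rewrite -eq_uv (leq_trans _ le_vu) // -(nbelow_card v (leqnn n))
    (nbelow_lt xv).
have [y [yu xy _]] := next_elt xu lt_u.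
have : x \notin colon_vars u.
  by apply: contra xu => xL; apply: TL; rewrite inE vT.
suff /colon_varsP -> : (exists2 y, y \in u & x <= y) /\
    forall w, w \in u -> w < x -> w + tau (nbelow u w) <= x by [].
split=> [|w wu wx]; first by exists y; rewrite // ltnW.
(* [w'] is the element of [v] in the position of w in [u]. Induction at w gives w <= w', so the
   spacing between w' and x in [v] bounds x from below. *)
have := nbelow_lt wu wx; rewrite -[nbelow u x]eq_uv =>
  /nbelow_ex[w' [w'v w'x e]].
rewrite -e; apply: leq_trans (spv w' x w'v xv w'x); rewrite leq_add2r leqNgt.
apply/negP => lt_w; have := nbelow_lt w'v lt_w; rewrite ltnNge e.
by rewrite IHs // ltnS ltnW.
Qed.

Lemma sum_nbelow u (F : nat -> nat) :
  \sum_(x in u) F (nbelow u x) = \sum_(h < #|u|) F h.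
Proof.
suff H z : \sum_(x in u | x < z) F (nbelow u x) = \sum_(h < nbelow u z) F h.
  rewrite -(nbelow_card u (leqnn n)) -H; apply: eq_bigl => x.
  by rewrite ltn_ord andbT.
elim: z => [|z IH]; first by rewrite nbelow0 big_ord0 big1 // => x /andP[].
have [zn|nz] := ltnP z n; last first.
  rewrite nbelow_card ?leqW // -(nbelow_card u nz) -IH; apply: eq_bigl => x.
  by rewrite ltnS !(leq_trans (ltn_ord x)) ?(ltnW (leq_trans (ltn_ord x) nz)).
pose x := Ordinal zn; rewrite (nbelowS u x).
have ltS (y : 'I_n) : (y < z.+1) = (y == x) || (y < z).
  by rewrite ltnS leq_eqVlt.
have [xu|xu] := boolP (x \in u); last first.
  rewrite addn0 -IH; apply: eq_bigl => y; rewrite ltS.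
  by have [->|] := eqVneq y x; rewrite ?(negPf xu).
rewrite addn1 big_ord_recr -IH (bigD1 x) /= ?xu ?ltnSn // addnC; congr (_ + _).
apply: eq_bigl => y; rewrite ltS.
by have [->|] := eqVneq y x; rewrite ?andbT ?andbF ?ltnn ?andbF.
Qed.

Lemma sum_interval a c M : c <= M ->
  \sum_(k < M) ((a < k) && (k < c)) = c - a.+1.
Proof.
move=> cM; have -> : c - a.+1 = minn c M - a.+1 by rewrite (minn_idPl cM).
elim: M {cM} => [|M IH]; first by rewrite big_ord0 minn0.
by rewrite big_ord_recr /= IH; lia.
Qed.

Lemma ltn_maxsupp u k : (k < maxsupp u) = [exists y in u, k <= y].
Proof.
apply/idP/existsP => [|[y /andP[yu ky]]]; last first.
  apply: (@leq_trans y.+1) => //.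
  by rewrite /maxsupp (bigD1 y) //= leq_maxl.
have [->|[y yu]] := set_0Vmem u; first by rewrite /maxsupp big_set0.
have u0 : 0 < #|u| by apply/card_gt0P; exists y.
have [w wu ew] := eq_bigmax_cond (fun y : 'I_n => y.+1) u0.
by rewrite /maxsupp ew => kw; exists w; rewrite wu.
Qed.

(** Each k < m(u) is in [colon_vars u] or strictly between x and x + t_h for exactly one non-last x
    of [u], h being its position. Spacing makes these intervals disjoint and keeps them below m(u);
    each holds t_h - 1 numbers, truncated. *)
Lemma card_colon_vars u : spaced u ->
  #|colon_vars u| + \sum_(h < #|u|.-1) (tau h - 1) = maxsupp u.
Proof.
move=> spu; have Mn : maxsupp u <= n by apply/bigmax_leqP => i _;
  apply: ltn_ord.
have nbS x y : x \in u -> y \in u -> x < y -> nbelow u x < #|u|.-1.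
  move=> xu yu xy; rewrite ltn_predRL (leq_ltn_trans (nbelow_lt xu xy)) //.
  by rewrite -(nbelow_card u (leqnn n)) (nbelow_lt yu).
pose bad (k : nat) (x : 'I_n) : bool := (x < k) && (k < x + tau (nbelow u x)).
pose inner x := (x \in u) && (nbelow u x < #|u|.-1).
transitivity (\sum_(k < n | k < maxsupp u)
                ((k \in colon_vars u) + \sum_(x | inner x) bad k x)).
  rewrite big_split /=; congr (_ + _).
    rewrite -sum1_card big_mkcond [RHS]big_mkcond /=; apply: eq_bigr => k _.
    case: (boolP (k \in _)) => [|_]; last by case: ifP.
    by rewrite inE ltn_maxsupp => /andP[-> _].
  rewrite exchange_big /=.
  transitivity (\sum_(x | inner x) (tau (nbelow u x) - 1)).
    rewrite /inner; have := sum_nbelow u (fun h =>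
      if h < #|u|.-1 then tau h - 1 else 0).
    rewrite -big_mkcondr /= => ->; rewrite (big_ord_widen _ (fun h =>
      tau h - 1) (leq_pred _)).
    by rewrite big_mkcond.
  apply: eq_bigr => x /andP[xu xlt].
  rewrite -(big_ord_widen _ (fun i : nat => bad i x : nat) Mn) sum_interval;
    first by lia.
  have [y [yu _ ey]] :
      exists y, [/\ y \in u, y < n & nbelow u y = (nbelow u x).+1].
    by apply: nbelow_ex; rewrite (nbelow_card u (leqnn n)) -ltn_predRL.
  have xy : x < y.
    by rewrite ltnNge; apply/negP => yx; have := leq_nbelow u yx;
      rewrite ey ltnn.
  rewrite (leq_trans (spu x y xu yu xy)) // ltnW // ltn_maxsupp.
  by apply/existsP; exists y; rewrite yu /=.
transitivity (\sum_(k < n | k < maxsupp u) 1); last first.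
  by rewrite -(big_ord_widen _ (fun=> 1) Mn) sum1_card card_ord.
apply: eq_bigr => k; rewrite ltn_maxsupp => /existsP[y /andP[yu ky]].
have [kL|kL] := boolP (k \in _).
  rewrite big1 // => x /andP[xu _]; have /colon_varsP[_ /(_ x xu)] := kL.
  by rewrite /bad; case: ltnP => // xk /(_ isT); rewrite leqNgt => /negPf->.
have [x xu xk] : exists2 x, x \in u & bad k x.
  have : ~~ [forall x in u, (x < k) ==> (x + tau (nbelow u x) <= k)].
    apply: contra kL => uk; rewrite inE uk andbT; apply/existsP; exists y.
    by rewrite yu.
  move=> /forallPn[x]; rewrite !negb_imply -ltnNge => /and3P[xu xk kx].
  by exists x; rewrite /bad ?xk.
have xy : x < y by have /andP[xk' _] := xk; apply: leq_trans xk' ky.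
rewrite (bigD1 x) /= ?xk; last by rewrite /inner xu (nbS x y).
rewrite big1 // => w /andP[/andP[wu _] wx].
have /andP[xk1 xk2] := xk; rewrite /bad.
have [wx'|xw|/val_inj ewx] := ltngtP w x; last by rewrite ewx eqxx in wx.
  by have := spu w x wu xu wx'; lia.
by have := spu x w xu wu xw; lia.
Qed.

(** * Strong stability gives linear quotients *)

Section Stable.
Variables (d : nat) (inI : pred {set 'I_n}).
Hypothesis exchI : forall S x y, spaced S -> #|S| <= d -> inI S ->
  y \in S -> x < y -> x \notin S -> spaced (x |: S :\ y) -> inI (x |: S :\ y).

(** Induction on the weight gap. The least x at which [V] and [W] differ lies in [W]; exchanging the
    next element of [V] for x keeps it spaced, since below x it agrees with the spaced set [W], and
    does not overshoot [W]. *)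
Lemma stable_le (V W : {set 'I_n}) : spaced V -> spaced W -> #|V| = #|W| ->
  #|V| <= d -> inI V -> (forall z, nbelow V z <= nbelow W z) -> inI W.
Proof.
have [m] := ubnP (weight W - weight V);
  elim: m V => // m IH V lt_m spV spW cVW cV IV leVW.
have [<- //|nVW] := eqVneq V W.
have [x0 dx0] : exists x, (x \in V) != (x \in W).
  apply/existsP; apply: contraNT nVW => /existsPn e; apply/eqP/setP => x.
  by have /negbNE/eqP := e x.
case: (@arg_minnP _ x0 (fun x =>
  (x \in V) != (x \in W)) (@nat_of_ord n) dx0) => x dx minx.
have eq_x : nbelow V x = nbelow W x.
  rewrite /nbelow big_mkcond [RHS]big_mkcond /=; apply: eq_bigr => y _.
  have [yx|] := ltnP y x; last by rewrite !if_same.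
  suff -> : (y \in V) = (y \in W) by [].
  by apply/eqP; apply: contraTT yx => /minx; rewrite -leqNgt.
have [xV xW] : x \notin V /\ x \in W.
  have := leVW x.+1; rewrite !nbelowS eq_x leq_add2l.
  by move: dx; do 2!case: (x \in _).
have ltx : nbelow V x < #|V|.
  by rewrite eq_x cVW -(nbelow_card W (leqnn n)) (nbelow_lt xW).
have [y [yV xy gap]] := next_elt xV ltx.
have eq_y : nbelow V y = nbelow V x.
  apply: eq_bigr => w wV; have := gap w wV;
    case: (ltngtP x w) => [xw /(_ isT)|wx _|xw].
  - by case: ltngtP.
  - by rewrite (ltn_trans wx xy).
  by move: xV; rewrite (val_inj xw) wV.
have spV' : spaced (x |: V :\ y).
  apply: spaced_exchange => // w wV wx.
  have wW : w \in W by apply: contraTT wx => wW;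
    rewrite -leqNgt minx // wV (negPf wW).
  have -> : nbelow V w = nbelow W w.
    rewrite /nbelow big_mkcond [RHS]big_mkcond /=; apply: eq_bigr => y' _.
    have [yw|] := ltnP y' w; last by rewrite !if_same.
    suff -> : (y' \in V) = (y' \in W) by [].
    apply/eqP; apply: contraTT (ltn_trans yw wx) => /minx; rewrite -leqNgt;
      exact.
  exact: spW.
have leV'W z : nbelow (x |: V :\ y) z <= nbelow W z.
  rewrite nbelow_exchange //; case: andP => [[xz zy]|_]; last by rewrite addn0.
  rewrite addn1; apply: leq_trans (leq_nbelow W xz);
    rewrite nbelowS xW addn1 ltnS -eq_x -eq_y.
  exact: leq_nbelow.
apply: (IH (x |: V :\ y)) => //.
- have lt1 := weight_exchange xV yV xy.
  have lt2 : weight (x |: V :\ y) <= weight W by apply: leq_sum => z _.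
  by move: lt_m; rewrite !ltnS; lia.
- by rewrite card_exchange.
- by rewrite card_exchange.
exact: exchI.
Qed.

Definition truncate u p : {set 'I_n} := [set x in u | nbelow u x < p].

Lemma nbelow_truncate u p z : nbelow (truncate u p) z = minn (nbelow u z) p.
Proof.
elim: z => [|z IH]; first by rewrite !nbelow0 min0n.
have [zn|nz] := ltnP z n; last first.
  by rewrite [in LHS]nbelow_card ?leqW // -(nbelow_card _ nz)
    IH !nbelow_card // leqW.
pose x := Ordinal zn; rewrite !(nbelowS _ x) inE [nbelow _ x]IH.
case: (x \in u); rewrite ?addn0 //= addn1.
by rewrite -[nbelow u x]/(nbelow u z); case: ltnP; lia.
Qed.

Lemma card_truncate u p : p <= #|u| -> #|truncate u p| = p.
Proof.
by move=> pu; rewrite -(nbelow_card _ (leqnn n))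
  nbelow_truncate nbelow_card //; lia.
Qed.

Lemma spaced_truncate u p : spaced u -> spaced (truncate u p).
Proof.
move=> spu x y; rewrite !inE => /andP[xu xp] /andP[yu _] xy.
by rewrite nbelow_truncate (minn_idPl (ltnW xp)) spu.
Qed.

Variable G : {set {set 'I_n}}.
Hypothesis GI : forall S, inI S = [exists g in G, g \subset S].
Hypothesis spG : {in G, forall g, spaced g}.
Hypothesis cG : {in G, forall g : {set 'I_n}, #|g| <= d}.
Hypothesis antiG : {in G &, forall g h : {set 'I_n}, g \subset h -> g = h}.

(* Orders by cardinality, then by decreasing weight.                          *)
Definition gen_key S := #|S| * (n.+1 * n.+1).+1 + ((n.+1 * n.+1).+1 - weight S).

Lemma gen_key_leq S T : gen_key S <= gen_key T ->
  #|S| <= #|T| /\ (#|S| = #|T| -> weight T <= weight S).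
Proof.
rewrite /gen_key; have := weight_lt S; have := weight_lt T.
move: (_.+1) #|S| #|T| (weight S) (weight T) => B s t ws wt wtB wsB le_k.
split; first by rewrite leqNgt; apply/negP => ts; nia.
by move=> st; rewrite st leq_add2l in le_k; lia.
Qed.

Definition sorted_gens := sort (relpre gen_key leq) (enum G).

Lemma linear_quotients_sorted_gens : linear_quotients colon_vars sorted_gens.
Proof.
move=> us1 u us2 eus.
have mem_us v : (v \in sorted_gens) = (v \in G) by rewrite mem_sort mem_enum.
have Gu : u \in G by rewrite -mem_us eus mem_cat mem_head orbT.
have G1 v : v \in us1 -> v \in G by rewrite -mem_us eus mem_cat => ->.
have: uniq sorted_gens by rewrite sort_uniq enum_uniq.
rewrite eus cat_uniq /= negb_or => /and3P[_ /andP[u_us1 _] _].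
have: sorted (relpre gen_key leq) sorted_gens.
  by apply: sort_sorted => S T; apply: leq_total.
rewrite sorted_pairwise; last by move=> S T W; apply: leq_trans.
rewrite eus pairwise_cat /= => /and3P[/allrelP le1 _ /andP[/allP le2 _]].
have {}le1 v : v \in us1 -> gen_key v <= gen_key u.
  by move=> v1; apply: le1; rewrite ?mem_head.
have spu := spG Gu; split; first exact: sub_colon_vars.
  by move=> v /le1/gen_key_leq[].
move=> S uS; have uSL : u \subset S :&: colon_vars u by rewrite subsetI uS
  sub_colon_vars.
apply/hasP/idP => [[v v1 vS]|nSL].
  apply/negP => /eqP SL; have [cvu wvu] := gen_key_leq (le1 v v1).
  have le_vu : forall z, nbelow v z <= nbelow u z.
    by apply: (nbelow_colon (spG (G1 v v1)) vS) => //; rewrite SL.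
  move: cvu; rewrite leq_eqVlt => /predU1P[cvu|cvu].
    by have evu := weight_eq le_vu (wvu cvu); rewrite -evu v1 in u_us1.
  (* If [v] is smaller than [u], the first [#|v|] elements of [u] lie below those of [v], so by
     stability they give a monomial of the ideal properly dividing e_u, against minimality. *)
  have : inI (truncate u #|v|).
    apply: (@stable_le v).
    - exact: spG (G1 v v1).
    - exact: spaced_truncate.
    - by rewrite (card_truncate (ltnW cvu)).
    - exact: cG (G1 v v1).
    - by rewrite GI; apply/existsP; exists v; rewrite G1 //=.
    by move=> z; rewrite nbelow_truncate leq_min le_vu nbelow_leq_card.
  rewrite GI => /existsP[g /andP[Gg gw]].
  have gu : g = u.
    apply: antiG => //; apply: subset_trans gw _; apply/subsetP => x.
    by rewrite inE => /andP[].
  have := subset_leq_card gw; rewrite gu (card_truncate (ltnW cvu)).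
  by rewrite leqNgt cvu.
have /subsetPn[k] : ~~ (S :&: colon_vars u \subset u).
  by apply: contra nSL => SLu; rewrite eqEsubset SLu.
rewrite inE => /andP[kS /colon_varsP[[y0 y0u ky0] low]] ku.
have ltk : nbelow u k < #|u|.
  rewrite -(nbelow_card u (leqnn n)) (leq_ltn_trans (leq_nbelow u ky0)) //.
  exact: nbelow_lt.
have [y [yu ky gap]] := next_elt ku ltk.
(* Membership of k in [colon_vars u] is what allows k to replace the next element y of [u]. *)
have spv := spaced_exchange spu ku yu ky gap low.
have Iu : inI u by rewrite GI; apply/existsP; exists u; rewrite Gu /=.
have : inI (k |: u :\ y) by apply: exchI => //; apply: cG.
rewrite GI => /existsP[g /andP[Gg gv]].
have gS : g \subset S.
  apply: subset_trans gv _; rewrite subUset sub1set kS.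
  exact: subset_trans (subsetDl _ _) uS.
exists g => //; have : g \in sorted_gens by rewrite mem_us.
(* [g] divides the exchanged monomial: it has fewer elements than [u], or it is the exchanged set
   itself, of larger weight. Either way it comes before [u]. *)
suff lt_g : gen_key g < gen_key u.
  rewrite eus mem_cat inE => /or3P[//|/eqP gu|/le2 /=];
    first by rewrite gu ltnn in lt_g.
  by rewrite leqNgt lt_g.
rewrite ltnNge; apply/negP => /gen_key_leq[cug wug].
have cv := card_exchange ku yu.
have egv : g = k |: u :\ y by apply/eqP; rewrite eqEcard gv cv.
have := wug; rewrite egv cv => /(_ erefl); rewrite leqNgt.
by rewrite weight_exchange.
Qed.

End Stable.

End Spaced.

(** * The spread condition in terms of positions *)

Section Spread.
Local Open Scope nat_scope.
Variable n : nat.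
Implicit Types S : {set 'I_n}.

Lemma sorted_enum S : sorted ltn [seq val i | i <- enum S].
Proof.
rewrite sorted_map /enum_mem sorted_filter //; first by move=> x y z;
  apply: ltn_trans.
by rewrite -enumT -sorted_map val_enum_ord iota_ltn_sorted.
Qed.

Lemma nbelow_nth S k : k < #|S| ->
  nbelow S (nth 0 [seq val i | i <- enum S] k) = k.
Proof.
move=> kS; have := @Order.PreorderTheory.count_lt_nth _ nat 0 _ k (sorted_enum
  S).
rewrite size_map -cardE => /(_ kS) eqk; rewrite -[RHS]eqk count_map -sum1_count.
by rewrite big_mkcond big_enum /=.
Qed.

(** Consecutive gaps bound all gaps because the enumeration increases; for the same reason the
    truncated differences are true ones. *)
Lemma spreadE d (t : d.-1.-tuple nat) S :
  spread t S = [&& S != set0, #|S| <= d &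
     [forall x in S, forall y in S,
        (x < y) ==> (x + nth 0 t (nbelow S x) <= y)]].
Proof.
rewrite /spread; congr [&& _, _ & _]; set s := map _ _.
have size_s : size s = #|S| by rewrite size_map -cardE.
have srt := sorted_enum S; rewrite -/s in srt.
have rank k := @nbelow_nth S k; rewrite -/s in rank.
have sP x : x \in S -> nbelow S x < #|S| /\ nth 0 s (nbelow S x) = x.
  move=> xS; have xs : val x \in s by apply: map_f; rewrite mem_enum.
  have := nth_index 0 xs; have := xs; rewrite -index_mem size_s => /rank.
  by move=> r e; rewrite e in r; rewrite r; split=> //;
    rewrite -size_s index_mem.
have sS k : k < #|S| -> exists2 x, x \in S & nth 0 s k = val x.
  rewrite -size_s => /(mem_nth 0)/mapP[x]; rewrite mem_enum => xS ->.
  by exists x.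
apply/forallP/forallP => [sp x|sp k].
  apply/implyP => xS; apply/forallP => y; apply/implyP => yS;
    apply/implyP => xy.
  have [xlt ex] := sP x xS; have [ylt ey] := sP y yS.
  have lt := nbelow_lt xS xy.
  have xlt' : nbelow S x < #|S|.-1 by rewrite ltn_predRL (leq_ltn_trans lt).
  have := sp (Ordinal xlt'); rewrite /= ex.
  suff : x <= nth 0 s (nbelow S x).+1 <= y by lia.
  rewrite -{1}ex -ey; apply/andP; split.
    apply: ltnW; apply: (sorted_ltn_nth ltn_trans 0 srt);
      rewrite ?inE ?size_s //.
    exact: leq_ltn_trans ylt.
  move: lt; rewrite leq_eqVlt => /predU1P[<- //|lt]; apply: ltnW.
  apply: (sorted_ltn_nth ltn_trans 0 srt); rewrite ?inE ?size_s //.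
  exact: ltn_trans ylt.
have k1 : k.+1 < #|S| by rewrite -ltn_predRL.
have k0 := ltnW k1.
have [x xS ex] := sS k k0; have [y yS ey] := sS k.+1 k1.
have xy : x < y.
  rewrite -[X in X < _]ex -[X in _ < X]ey.
  by apply: (sorted_ltn_nth ltn_trans 0 srt); rewrite ?inE ?size_s.
have /implyP/(_ xS)/forallP/(_ y)/implyP/(_ yS)/implyP/(_ xy) := sp x.
have -> : nbelow S x = k by rewrite -(rank k k0) ex.
rewrite ey ex /=; lia.
Qed.

Lemma spreadP d (t : d.-1.-tuple nat) S :
  reflect [/\ S != set0, #|S| <= d & spaced (nth 0 t) S] (spread t S).
Proof.
rewrite spreadE; apply: (iffP and3P) => -[S0 Sd spS]; split=> //.
  move=> x y xS yS xy.
  by have /implyP/(_ xS)/forallP/(_ y)/implyP/(_ yS)/implyP/(_ xy) :=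
    forallP spS x.
apply/forallP => x; apply/implyP => xS; apply/forallP => y; apply/implyP => yS.
by apply/implyP; apply: spS.
Qed.

End Spread.

(** * Minimal monomial generators *)

Section Mingens.
Variables (K : fieldType) (n : nat) (A : {set {set 'I_n}}).
Local Notation I := (ideal_gen K A).

Lemma mingens_minset :
  minset (fun B => ideal_gen K B == I) (mingens I).
Proof. by rewrite mingensP. Qed.

Lemma ideal_gen_mingens : ideal_gen K (mingens I) = I.
Proof. by have /minsetP[/eqP] := mingens_minset. Qed.

Lemma mingens_sub : mingens I \subset A.
Proof.
have [B minB sBA] := minset_exists (eqxx I : (fun B => ideal_gen K B == I) A).
by move: minB; rewrite mingensP => /eqP <-.
Qed.

Lemma mingens_anti : {in mingens I &, forall S T : {set 'I_n},
  S \subset T -> S = T}.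
Proof.
move=> S T GS GT sST; apply/eqP; apply: contraT => nST.
have /minsetP[_ minG] := mingens_minset.
have eG : mingens I :\ T = mingens I.
  apply: minG; last exact: subD1set.
  apply/eqP; rewrite -[RHS]ideal_gen_mingens; apply/vspaceP => x;
    rewrite !mem_ideal_gen.
  apply: eq_forallb => U; congr (_ ==> _); apply/existsP/existsP => -[V].
    by rewrite inE => /andP[/andP[_ GV] VU]; exists V; rewrite GV.
  move=> /andP[GV VU]; have [eVT|nVT] := eqVneq V T.
    by exists S; rewrite !inE nST GS (subset_trans sST) // -eVT.
  by exists V; rewrite !inE nVT GV.
by have := setD11 T (mingens I); rewrite eG GT.
Qed.

End Mingens.

Theorem corollary5p5 (K : fieldType) (n d : nat) (t : d.-1.-tuple nat)
    (I : {vspace ext K n}) :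
  (1 <= n)%N -> (2 <= d)%N -> strongly_stable t I ->
  forall i j : nat, (1 <= j)%N ->
    betti I i (i + j)%N =
    (\sum_(S in mingens I | #|S| == j)
       'C(maxsupp S - \sum_(1 <= h < j) (nth 0 t h.-1 - 1) + i - 1, i))%N.
Proof.
move=> _ _ [[A spA eI] stI] i j j1; subst I; set I := ideal_gen K A.
pose G := mingens I; pose tau := nth 0%N t.
pose inI S := emon K S \in I.
have GI S : inI S = [exists g in G, g \subset S].
  by rewrite /inI /I -ideal_gen_mingens mem_emon_ideal_gen.
have spG g : g \in G -> [/\ g != set0, (#|g| <= d)%N & spaced tau g].
  by move=> Gg; apply/spreadP/spA/(subsetP (mingens_sub K A)).
have exchI (S : {set 'I_n}) (x y : 'I_n) :
    spaced tau S -> (#|S| <= d)%N -> inI S -> y \in S -> (x < y)%N ->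
    x \notin S -> spaced tau (x |: S :\ y) -> inI (x |: S :\ y).
  move=> spS Sd IS yS xy xS spS'.
  have spreadS : spread t S by apply/spreadP; split=> //; apply/set0Pn;
    exists y.
  have spreadS' : spread t (x |: S :\ y).
    apply/spreadP; split=> //; last by rewrite card_exchange.
    by apply/set0Pn; exists x; rewrite setU11.
  have := stI S spreadS IS x y yS xy xS spreadS'.
  rewrite emon_mul disjoints1 !inE (negPf xS) andbF /=.
  move=> /(memvZ ((-1) ^+ ext_inv [set x] (S :\ y))).
  by rewrite sign_scaleK.
have spG' : {in G, forall g, spaced tau g} by move=> g /spG[].
have cG : {in G, forall g : {set 'I_n}, (#|g| <= d)%N} by move=> g /spG[].
have lq := linear_quotients_sorted_gens exchI GI spG' cG (@mingens_anti K n A).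
have grI : graded_submod (ideal_fmod I) by apply: ideal_gen_graded.
(* [i.+3] is the least truncation at which [hdim_linear_quotients] applies at place [i]. *)
have ib : (i.+2 < i.+3)%N by [].
rewrite /betti (@tor_dim_std_res K n i.+3) // 1?ltnW //.
have memG : G =i sorted_gens G by move=> g; rewrite mem_sort mem_enum.
rewrite [in LHS]/I -[in LHS]ideal_gen_mingens (ideal_fmodE K memG).
have [-> // _] := hdim_linear_quotients K i.+3 lq.
rewrite /sorted_gens (perm_big (enum G)) /=; last by rewrite perm_sort.
rewrite big_enum_cond /=; apply: eq_big => [g|g /andP[Gg /eqP ej]].
  by congr (_ && _); rewrite eqn_add2l; apply: eq_sym.
rewrite card_supp_in 1?ltnW //; congr 'C(_ + i - 1, i).
(* m(u) becomes [#|colon_vars u|] plus the sum, so the truncated difference in the binomial is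
   exact. *)
rewrite -(card_colon_vars (spG' _ Gg)); move/eqP: ej;
  rewrite eqn_add2l => /eqP <-.
by rewrite big_add1 big_mkord addnK.
Qed.
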